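(* Let $U\subset\mathbb{C}^n$ be a pseudoconvex domain with $C^2$ boundary. Then $U$ is Levi pseudoconvex.
   Context: A domain is a connected open set. A function $f\colon U\to\mathbb{R}$ is an exhaustion function for $U$ if $f^{-1}((-\infty,r])$ is compact for every $r\in\mathbb{R}$. An upper-semicontinuous function $f\colon V\to[-\infty,\infty)$ on an open set $V\subset\mathbb{C}$ is subharmonic if for every closed disc $\overline{B(a,r)}\subset V$ ($r>0$) and every continuous $\phi\colon\overline{B(a,r)}\to\mathbb{R}$ that is harmonic on $B(a,r)$ with $\phi\ge f$ on $\partial B(a,r)$, one has $\phi\ge f$ on $B(a,r)$. An upper-semicontinuous $f\colon V\to[-\infty,\infty)$ on an open $V\subset\mathbb{C}^n$ is plurisubharmonic if for every $a\in V$ and $\delta\in\mathbb{C}^n$ with $|\delta|=1$ the function $z\mapsto f(a+\delta z)$ is subharmonic on $\{z\in\mathbb{C}: a+\delta z\in V\}$. A domain $U\subset\mathbb{C}^n$ is pseudoconvex if it admits a continuous plurisubharmonic exhaustion function $U\to\mathbb{R}$. A local defining function for a domain $U$ at $a\in\partial U$ is a function $f\colon V\to\mathbb{R}$, $V$ an open neighbourhood of $a$, with $U\cap V=f^{-1}((-\infty,0))$. The domain $U$ has $C^2$ boundary if at each $a\in\partial U$ there is a $C^2$ (in the real sense) local defining function whose gradient at $a$ is non-zero. For domains with $C^2$ boundary, all local defining functions at $a$ are required to be $C^2$ with non-zero gradient at $a$, and (after shrinking $V$) to satisfy $\partial U\cap V=f^{-1}(\{0\})$. The complex tangent space at $a$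 with respect to $f$ is $T^c_a(f)=\{\delta\in\mathbb{C}^n:\sum_{j=1}^n\frac{\partial f}{\partial z_j}\big|_a\delta_j=0\}$, and the Levi form is $\Delta_\delta f(a)=\sum_{j,k=1}^n\frac{\partial^2 f}{\partial z_j\partial\overline{z}_k}\big|_a\delta_j\overline{\delta}_k$. A domain $U$ with $C^2$ boundary is Levi pseudoconvex if at every $a\in\partial U$ there is a $C^2$ local defining function $f$ such that $\Delta_\delta f(a)\ge0$ for all $\delta\in T^c_a(f)$. *)

(* Defs.v *)
(* C is R[i] for an arbitrary realType R, and C^n is 'rV[R[i]]_n.  A function   *)
(* given on a set W is represented by a total function: only its values on W  *)
(* are used, derivatives being taken at points of open sets W.                *)
From HB Require Import structures.
From mathcomp Require Import all_boot all_order all_algebra.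
From mathcomp Require Import all_classical all_reals all_analysis complex.

Set Implicit Arguments.
Unset Strict Implicit.
Unset Printing Implicit Defensive.

Import Order.TTheory GRing.Theory Num.Theory numFieldNormedType.Exports.

Local Open Scope classical_set_scope.
Local Open Scope ring_scope.
Local Open Scope complex_scope.

(* The library puts the modulus topology only on the alias R[i]^o; with this   *)
(* instance R[i] and 'rV[R[i]]_n are normed spaces over R[i] (the latter with  *)
(* the sup norm, which induces the usual topology of C^n).                     *)
#[warnings="-redundant-canonical-projection"]
HB.instance Definition _ (R : rcfType) := NormedModule.copy R[i] R[i]^o.

Definition imC {R : realType} : R[i] := 0 +i* 1.

Section RealDifferentiation.
Context {R : realType} {V : normedModType R[i]}.
Implicit Types (f : V -> R) (g : V -> R[i]) (a v : V) (W : set V).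

Definition rderivable f a v : Prop :=
  derivable (fun t : R => f (a + t%:C *: v)) 0 1.

Definition rderive v f : V -> R :=
  fun a => derive1 (fun t : R => f (a + t%:C *: v)) 0.

Definition cderive v g : V -> R[i] := fun a =>
  rderive v (fun z => complex.Re (g z)) a
    +i* rderive v (fun z => complex.Im (g z)) a.

(* e is meant to be a basis of V over R, so that the rderive (e i) f are the   *)
(* partial derivatives of f in the corresponding real coordinates.             *)
Definition C1_on (I : Type) (e : I -> V) W f : Prop :=
  forall i, (forall a, W a -> rderivable f a (e i)) /\
            {within W, continuous (rderive (e i) f)}.

Definition C2_on (I : Type) (e : I -> V) W f : Prop :=
  C1_on e W f /\ forall i, C1_on e W (rderive (e i) f).

End RealDifferentiation.

Section Subharmonic.
Context {R : realType}.
Implicit Types (W : set R[i]) (a z : R[i]) (r : R).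

Definition frameC (b : bool) : R[i] := if b then imC else 1.

Definition harmonic_on W (phi : R[i] -> R) : Prop :=
  C2_on frameC W phi /\
  forall z, W z ->
    rderive (1 : R[i]) (rderive (1 : R[i]) phi) z
      + rderive (imC : R[i]) (rderive (imC : R[i]) phi) z = 0.

Definition disc a r : set R[i] := [set z | Normc.normc (z - a) < r].
Definition closed_disc a r : set R[i] := [set z | Normc.normc (z - a) <= r].
Definition circle a r : set R[i] := [set z | Normc.normc (z - a) = r].

(* The first clause says that f takes its values in [-oo, +oo) on W.           *)
Definition usc_on (T : topologicalType) (W : set T) (f : T -> \bar R) : Prop :=
  (forall x, W x -> (f x < +oo)%E) /\
  (forall x, W x -> forall c : R, (f x < c%:E)%E ->
     \forall y \near x, W y -> (f y < c%:E)%E).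

Definition subharmonic W (f : R[i] -> \bar R) : Prop :=
  usc_on W f /\
  forall a r, 0 < r -> closed_disc a r `<=` W ->
  forall phi : R[i] -> R,
    {within closed_disc a r, continuous phi} ->
    harmonic_on (disc a r) phi ->
    (forall z, circle a r z -> (f z <= (phi z)%:E)%E) ->
    forall z, disc a r z -> (f z <= (phi z)%:E)%E.

End Subharmonic.

Section SeveralComplexVariables.
Context {R : realType} {n : nat}.
Local Notation Cn := 'rV[R[i]]_n.
Implicit Types (U V : set Cn) (a d : Cn) (f : Cn -> R) (g : Cn -> R[i]).

Definition euclidean_norm d : R :=
  Num.sqrt (\sum_(j < n) Normc.normc (d ord0 j) ^+ 2).

Definition plurisubharmonic V (f : Cn -> \bar R) : Prop :=
  usc_on V f /\
  forall a d, V a -> euclidean_norm d = 1 ->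
    subharmonic [set z : R[i] | V (a + z *: d)] (fun z => f (a + z *: d)).

Definition domain U : Prop := open U /\ connected U.

Definition exhaustion U (u : Cn -> R) : Prop :=
  forall r : R, compact (U `&` [set z | u z <= r]).

Definition pseudoconvex U : Prop :=
  domain U /\
  exists u : Cn -> R,
    [/\ {within U, continuous u},
        plurisubharmonic U (fun z => (u z)%:E) &
        exhaustion U u].

Definition bdry U : set Cn := closure U `\` U°.

Definition unit_x (j : 'I_n) : Cn := delta_mx ord0 j.
Definition unit_y (j : 'I_n) : Cn := imC *: delta_mx ord0 j.

Definition frameCn (p : 'I_n * bool) : Cn :=
  if p.2 then unit_y p.1 else unit_x p.1.

Definition gradient f a : 'rV[R]_(n + n) :=
  row_mx (\row_j rderive (unit_x j) f a) (\row_j rderive (unit_y j) f a).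

Definition local_defining U a V f : Prop :=
  open_nbhs a V /\ U `&` V = V `&` [set z | f z < 0].

Definition C2_defining U a V f : Prop :=
  [/\ local_defining U a V f, C2_on frameCn V f & gradient f a != 0].

(* No condition on the zero set of f is assumed here; levi_pseudoconvex asks   *)
(* for it in addition.                                                         *)
Definition C2_boundary U : Prop :=
  forall a, bdry U a -> exists V f, C2_defining U a V f.

Definition wirtinger (j : 'I_n) g : Cn -> R[i] := fun a =>
  (cderive (unit_x j) g a - imC * cderive (unit_y j) g a) / 2%:R.

Definition wirtinger_bar (j : 'I_n) g : Cn -> R[i] := fun a =>
  (cderive (unit_x j) g a + imC * cderive (unit_y j) g a) / 2%:R.

Definition complex_tangent f a : set Cn :=
  [set d | \sum_(j < n) wirtinger j (fun z => (f z)%:C) a * d ord0 j = 0].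

Definition levi_form f a d : R[i] :=
  \sum_(j < n) \sum_(k < n)
    wirtinger j (wirtinger_bar k (fun z => (f z)%:C)) a
      * d ord0 j * conjc (d ord0 k).

(* In the order of R[i], 0 <= w says that w is real and nonnegative.           *)
Definition levi_pseudoconvex U : Prop :=
  [/\ domain U, C2_boundary U &
      forall a, bdry U a -> exists V f,
        [/\ C2_defining U a V f,
            bdry U `&` V = V `&` [set z | f z = 0] &
            forall d, complex_tangent f a d -> 0 <= levi_form f a d]].

End SeveralComplexVariables.

(* Main.v *)
(* Let f be a C^2 defining function at a and suppose that the Levi form of f is
   negative in a complex tangent direction at a.  For small c > 0 this persists for
   g = f + c |z - a|^2, now with {g <= 0} contained near a in the union of U and {a},
   and at every p near a some complex direction tangent to the level set of g at
   p has negative Levi form.  A plurisubharmonic u cannot touch h(g) from below at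
   such a p when h is smooth and increasing: the term in h'' vanishes on tangent
   directions, so h(g) is strictly superharmonic to second order along a complex
   line.  Taking for h a steep exponential gives a maximum principle for u on the
   sets {g <= -s} near a, in which only the part of the boundary away from a
   counts.  There u is bounded independently of s, by compactness, so u stays
   bounded along points of {g < 0} tending to a, and u is not an exhaustion.

   Everything uses only complex lines, the only discs in the definition of
   plurisubharmonicity. *)
Require Import Defs.
From mathcomp Require Import all_boot all_order all_algebra.
From mathcomp Require Import all_classical all_reals all_analysis complex.
From mathcomp Require Import ring lra.

Set Implicit Arguments.
Unset Strict Implicit.
Unset Printing Implicit Defensive.

Import Order.TTheory GRing.Theory Num.Theory numFieldNormedType.Exports.

Local Open Scope classical_set_scope.
Local Open Scope ring_scope.
Local Open Scope complex_scope.

(** * Differentiation along real lines in a complex normed space *)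

Section RealLines.
Context {R : realType} {V : normedModType R[i]}.
Implicit Types (f : V -> R) (p q v w : V) (W : set V) (t : R).

Lemma realCD (s t : R) : (s + t)%:C = s%:C + t%:C :> R[i].
Proof. exact: rmorphD. Qed.

Lemma realCM (s t : R) : (s * t)%:C = s%:C * t%:C :> R[i].
Proof. exact: rmorphM. Qed.

Lemma normC_real t : `|t%:C| = `|t|%:C.
Proof. by rewrite normc_def /= expr0n /= addr0 sqrtr_sqr. Qed.

Lemma gt0_complexE (e : R[i]) : 0 < e -> e = (complex.Re e)%:C /\ 0 < complex.Re e.
Proof. by case: e => x y; rewrite ltcE /= => /andP[/eqP -> ->]. Qed.

(** Norms on [V] take values in [R[i]], so radii are a priori complex; a positive complex number is
    real, which gives balls of real radius. *)
Lemma nbhs_realP p (A : set V) :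
  nbhs p A <-> exists2 r : R, 0 < r & forall q, `|q - p| < r%:C -> A q.
Proof.
split.
  move=> /nbhs_normP[e /= /gt0_complexE[-> e0] eA]; exists (complex.Re e) => // q qp.
  by apply: eA; rewrite /= distrC.
move=> [r r0 rA]; apply/nbhs_normP; exists r%:C; first by rewrite /= ltcR.
by move=> q /=; rewrite distrC; exact: rA.
Qed.

Lemma continuous_realC : continuous (fun t : R => t%:C : R[i]).
Proof.
move=> t; apply/cvgrPdist_lt => e /gt0_complexE[-> e0].
apply/(@nbhs_normP R R t); exists (complex.Re e) => //= s.
by rewrite -raddfB /= normC_real ltcR.
Qed.

Lemma cvg_line p v :
  (fun x : V * R => x.1 + x.2%:C *: v) @ (nbhs p, nbhs (0 : R)) --> p.
Proof.
rewrite -[in X in _ --> X](addr0 p) -(scale0r v).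
apply: cvgD; first exact: cvg_fst.
apply: cvgZr_tmp.
apply: cvg_comp; [exact: cvg_snd|exact: continuous_realC].
Qed.

(** [rderive] always differentiates at parameter 0 from a moved base point. The difference quotients
    at parameter [t] from [p] are literally those at 0 from [p + t v], which makes one-variable
    calculus on the whole line available. *)
Lemma is_derive_line f p v t : rderivable f (p + t%:C *: v) v ->
  is_derive t 1 (fun s : R => f (p + s%:C *: v)) (rderive v f (p + t%:C *: v)).
Proof.
set g := fun s : R => f (p + s%:C *: v).
set g0 := fun s : R => f (p + t%:C *: v + s%:C *: v).
have E : (fun h : R => h^-1 *: ((g \o shift t) (h *: 1) - g t)) =
         (fun h : R => h^-1 *: ((g0 \o shift 0) (h *: 1) - g0 0)).
  apply/funext => h; rewrite /g /g0 /= [h *: 1]mulr1 addr0 realCD scalerDl.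
  by rewrite scale0r addr0 (addrC _ (t%:C *: v)) addrA.
move=> dg0; split; first by rewrite /derivable E.
by rewrite /rderive derive1E /derive E.
Qed.

Lemma line_MVT f p v (T : R) :
  (forall t, `|t| <= `|T| -> rderivable f (p + t%:C *: v) v) ->
  exists2 c, `|c| <= `|T| &
    f (p + T%:C *: v) - f p = rderive v f (p + c%:C *: v) * T.
Proof.
move=> df.
(* An ordered interval is needed: [[0, T]] or [[T, 0]] according to the sign of [T]. Only the bound
   on [|c|] is kept, which treats both signs alike. *)
have mvt a b : a < b -> (forall x, a <= x <= b -> `|x| <= `|T|) ->
    exists2 c, `|c| <= `|T| &
    f (p + b%:C *: v) - f (p + a%:C *: v) = rderive v f (p + c%:C *: v) * (b - a).
  move=> ab abT; have [] := @MVT R (fun s => f (p + s%:C *: v))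
    (fun s => rderive v f (p + s%:C *: v)) a b ab.
  - move=> x; rewrite in_itv /= => /andP[ax xb].
    by apply: is_derive_line; apply: df; apply: abT; rewrite !ltW.
  - apply: derivable_within_continuous => x; rewrite in_itv /= => xab.
    by have [] := is_derive_line (df x (abT _ xab)).
  move=> c; rewrite in_itv /= => /andP[ac cb] E.
  by exists c => //; apply: abT; rewrite !ltW.
have [T0|T0|T0] := ltgtP 0 T.
- have [|c cT] := mvt _ _ T0; first by move=> x /andP[x0 xT]; rewrite !ger0_norm // ltW.
  by rewrite scale0r addr0 subr0; exists c.
- have [|c cT] := mvt _ _ T0.
    by move=> x /andP[x0 xT]; rewrite !ler0_norm ?lerN2 // ltW.
  rewrite scale0r addr0 sub0r mulrN => E; exists c => //.
  by rewrite -opprB E opprK.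
- by exists 0; rewrite -?T0 ?scale0r ?addr0 ?subrr ?mulr0.
Qed.

(* Uniformity in the base point q is what makes derivatives additive in the
   direction, which plain directional derivatives are not. *)
Definition strict_rderive f p v (D : R) : Prop := forall eps : R, 0 < eps ->
  \forall q \near p & t \near (0 : R),
    `|f (q + t%:C *: v) - f q - t * D| <= eps * `|t|.

Lemma near_line p v (A : set V) : nbhs p A ->
  \forall q \near p & t \near (0 : R), A (q + t%:C *: v).
Proof. by move=> pA; exact: (@cvg_line p v A pA). Qed.

(** A ball about 0 in [R] is symmetric, so with [t] it contains every [s] with [|s| <= |t|]. This
    keeps the intermediate points of the mean value theorem inside [A]. *)
Lemma near_segment p v (A : set V) : nbhs p A ->
  \forall q \near p & t \near (0 : R),
    forall s : R, `|s| <= `|t| -> A (q + s%:C *: v).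
Proof.
move=> /(near_line v)[[B C]] /= [pB C0] BCA.
have /(@nbhs_normP R R)[r /= r0 rC] := C0.
exists (B, ball_ Num.Def.normr 0 r) => /=.
  by split=> //; apply/(@nbhs_normP R R); exists r.
move=> [q t] /= [Bq]; rewrite sub0r normrN => tr s st.
by apply: (BCA (q, s)); split => //=; apply: rC; rewrite /= sub0r normrN (le_lt_trans st).
Qed.

Lemma near2_refl p (P : V -> R -> Prop) :
  (\forall q \near p & t \near (0 : R), P q t) -> \forall t \near (0 : R), P p t.
Proof.
move=> [[B C]] /= [pB C0] BC; apply: filterS C0 => t Ct.
by apply: (BC (p, t)); split => //=; exact: nbhs_singleton.
Qed.

(** By the mean value theorem the increment from [q] is [t] times a partial derivative at a point
    near [p], and continuity of that derivative at [p] gives an error uniform in [q]. *)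
Lemma C1_strict I (e : I -> V) W f i p : open W -> C1_on e W f -> W p ->
  strict_rderive f p (e i) (rderive (e i) f p).
Proof.
move=> oW /(_ i)[df cf] Wp eps eps0.
have cfp : {for p, continuous (rderive (e i) f)}.
  by move: cf; rewrite continuous_open_subspace // => /(_ p); apply; rewrite inE.
have nW : \forall q \near p, W q by exact: open_nbhs_nbhs.
have nD : \forall q \near p, `|rderive (e i) f p - rderive (e i) f q| <= eps.
  by move/cvgrPdist_le : cfp; apply.
have nWD : nbhs p (W `&` [set q | `|rderive (e i) f p - rderive (e i) f q| <= eps]).
  exact: filterI.
have := near_segment (e i) nWD; apply: filterS => -[q t] /= H.
have [c ct ->] := line_MVT (fun s st => df _ (H s st).1).
rewrite (mulrC t) -mulrBl normrM ler_wpM2r // distrC.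
exact: (H c ct).2.
Qed.

(** The increment along [v + w] is split at [q + t v]; the second half starts from a base point that
    moves with [t], which a strict derivative permits. *)
Lemma strictD f p v w D E : strict_rderive f p v D -> strict_rderive f p w E ->
  strict_rderive f p (v + w) (D + E).
Proof.
move=> sv sw eps eps0; have e2 : 0 < eps / 2 by rewrite divr_gt0.
have := sw _ e2; have := sv _ e2.
move=> [[B C]] /= [pB C0] BC [[B' C']] /= [pB' C0'] BC'.
have [[B2 C2] /= [pB2 C02] BC2] := near_line v pB'.
exists (B `&` B' `&` B2, C `&` C' `&` C2) => /=; first by split; do 2?apply: filterI.
move=> [q t] /= [[[qB qB'] qB2] [[tC tC'] tC2]].
have := BC (q, t) (conj qB tC); have := BC' (_, t) (conj (BC2 (q, t) (conj qB2 tC2)) tC').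
rewrite /= => H1 H2; rewrite scalerDr addrA.
have -> : eps * `|t| = eps / 2 * `|t| + eps / 2 * `|t| by field.
apply: le_trans (lerD H1 H2); apply: le_trans (ler_normD _ _).
by rewrite le_eqVlt; apply/orP; left; apply/eqP; congr `|_|; ring.
Qed.

Lemma strictZ f p v D (c : R) : strict_rderive f p v D ->
  strict_rderive f p (c%:C *: v) (c * D).
Proof.
move=> sv eps eps0.
(* The summand 1 keeps the denominator positive when [c = 0]. *)
have e2 : 0 < eps / (1 + `|c|) by rewrite divr_gt0 // ltr_pwDl.
have [[B C] /= [pB C0] BC] := sv _ e2.
exists (B, (fun t => C (t * c))) => /=.
  split => //; have : (fun t : R => t * c) @ (0 : R) --> 0 * c.
    exact: (cvgM (@cvg_id R (nbhs (0:R))) (cvg_cst c)).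
  by rewrite mul0r => /(_ C C0).
move=> [q t] /= [qB tC]; have := BC (q, t * c) (conj qB tC).
rewrite /= scalerA -realCM mulrA => /le_trans; apply.
rewrite normrM mulrA (mulrAC _ `|t|) ler_wpM2r //.
rewrite mulrAC ler_pdivrMr ?ltr_pwDl // ler_wpM2l ?(ltW eps0) //.
by rewrite lerDr.
Qed.

Lemma strict0 f p : strict_rderive f p 0 0.
Proof.
move=> eps eps0; have : \forall q \near p & t \near (0 : R), True by exact: filterT.
apply: filterS => -[q t] _ /=.
by rewrite scaler0 addr0 subrr mulr0 subrr normr0 mulr_ge0 // ltW.
Qed.

Lemma strict_rderivable f p v D : strict_rderive f p v D ->
  rderivable f p v /\ rderive v f p = D.
Proof.
move=> sv; set g := fun t : R => f (p + t%:C *: v).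
have H : (fun h : R => h^-1 *: ((g \o shift 0) (h *: 1) - g 0)) @ 0^' --> D.
  apply/cvgrPdist_le => eps eps0.
  have /near2_refl := sv _ eps0; rewrite /dnbhs /within /=; apply: filterS => h.
  rewrite /g /= [h *: 1]mulr1 !addr0 scale0r addr0 => Hh h0.
  have -> : D - h^-1 * (f (p + h%:C *: v) - f p) =
      - (h^-1 * (f (p + h%:C *: v) - f p - h * D)) by field.
  by rewrite normrN normrM normfV ler_pdivrMl ?normr_gt0 // (mulrC `|h|).
split; first by apply/cvg_ex; exists D.
by rewrite /rderive derive1E /derive; apply: cvg_lim.
Qed.

Lemma within_openP W f : open W ->
  {within W, continuous f} <-> forall p, W p -> {for p, continuous f}.
Proof.
move=> oW; rewrite continuous_open_subspace //; split=> cf p.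
  by move=> Wp; apply: cf; rewrite inE.
by rewrite inE; exact: cf.
Qed.

Lemma continuous_at_eq (T : topologicalType) W (f g : V -> T) p :
  open W -> {in W, f =1 g} -> W p -> {for p, continuous g} -> {for p, continuous f}.
Proof.
move=> oW fg Wp cg; rewrite /prop_for /continuous_at fg ?inE //.
apply: cvg_trans cg; apply: near_eq_cvg.
have : nbhs p W by exact: open_nbhs_nbhs.
by apply: filterS => q Wq; rewrite /= fg // inE.
Qed.

(** * From partial derivatives in a frame to derivatives in every direction *)

Lemma strict_sum f p (I : finType) (v : I -> V) (D : I -> R) :
  (forall i, strict_rderive f p (v i) (D i)) ->
  strict_rderive f p (\sum_i v i) (\sum_i D i).
Proof.
move=> H; apply: (big_ind2 (fun v D => strict_rderive f p v D)) => //.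
- exact: strict0.
- by move=> *; exact: strictD.
Qed.

Lemma C1_span_rderive (I : finType) (e : I -> V) W f (c : I -> R) p :
  open W -> C1_on e W f -> W p ->
  strict_rderive f p (\sum_i (c i)%:C *: e i) (\sum_i c i * rderive (e i) f p).
Proof.
by move=> oW fC Wp; apply: strict_sum => i; apply: strictZ; exact: C1_strict fC Wp.
Qed.

Lemma continuous_at_sum (I : finType) (f : I -> V -> R) p :
  (forall i, {for p, continuous (f i)}) -> {for p, continuous (fun z => \sum_i f i z)}.
Proof.
move=> fc; rewrite (_ : (fun z => _) = \sum_i f i); last first.
  by apply/funext => z; rewrite fct_sumE.
apply: (big_ind (fun g => {for p, continuous g})) => //; first exact: cvg_cst.
by move=> f1 f2 c1 c2; exact: (cvgD c1 c2).
Qed.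

(** With the family [id], indexed by [V] itself, [C1_on] concerns all directions at once. The
    derivative along a combination of the [e i] is the same combination of partial derivatives,
    hence continuous. Later calculus uses this frame-free form. *)
Lemma C1_span (I : finType) (e : I -> V) W f :
  (forall v, exists c : I -> R, v = \sum_i (c i)%:C *: e i) ->
  open W -> C1_on e W f -> C1_on id W f.
Proof.
move=> span oW fC v; have [c ->] := span v.
have E p : W p -> _ := fun Wp => strict_rderivable (C1_span_rderive c oW fC Wp).
split; first by move=> p /E[].
apply/within_openP => // p Wp; apply: (continuous_at_eq oW _ Wp).
  by move=> q; rewrite inE => /E[_ ->].
apply: continuous_at_sum => i; apply: cvgM; first exact: cvg_cst.
by have [_ /(within_openP _ oW)] := fC i; apply.
Qed.

Lemma C1_rderiveD W f v w p : open W -> C1_on id W f -> W p ->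
  rderive (v + w) f p = rderive v f p + rderive w f p.
Proof.
move=> oW fC Wp.
by have [] := strict_rderivable (strictD (C1_strict v oW fC Wp) (C1_strict w oW fC Wp)).
Qed.

Lemma C1_rderiveZ W f v (c : R) p : open W -> C1_on id W f -> W p ->
  rderive (c%:C *: v) f p = c * rderive v f p.
Proof.
by move=> oW fC Wp; have [] := strict_rderivable (strictZ c (C1_strict v oW fC Wp)).
Qed.

Lemma C1_rderive_sum W f (I : finType) (v : I -> V) p : open W -> C1_on id W f -> W p ->
  rderive (\sum_i v i) f p = \sum_i rderive (v i) f p.
Proof.
move=> oW fC Wp; have S := strict_sum (fun i => C1_strict (v i) oW fC Wp).
by have [] := strict_rderivable S.
Qed.

Lemma strict_congr W f g p v D : open W -> {in W, f =1 g} -> W p ->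
  strict_rderive g p v D -> strict_rderive f p v D.
Proof.
move=> oW fg Wp sg eps eps0.
have nW : nbhs p W by exact: open_nbhs_nbhs.
have [[B C] /= [pB C0] BC] := near_line v nW.
have [[B' C'] /= [pB' C0'] BC'] := sg _ eps0.
exists (B `&` B' `&` W, C `&` C') => /=.
  by split; [apply: filterI => //; apply: filterI|apply: filterI].
move=> [q t] /= [[[qB qB'] qW] [tC tC']].
have qtW : W (q + t%:C *: v) := BC (q, t) (conj qB tC).
by rewrite !fg ?inE //; exact: (BC' (q, t) (conj qB' tC')).
Qed.

(** In this form closure properties follow by exhibiting the candidate derivatives [D], instead of
    computing [rderive] beforehand. *)
Lemma C1_strictP W f : open W ->
  C1_on id W f <-> exists D : V -> V -> R, forall p v, W p ->
    strict_rderive f p v (D v p) /\ {for p, continuous (D v)}.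
Proof.
move=> oW; split.
  move=> fC; exists (fun v => rderive v f) => p v Wp.
  split; first exact: (C1_strict v oW fC Wp).
  by have [_ /(within_openP _ oW)] := fC v; apply.
move=> [D DP] v; split; first by move=> p /(DP p v)[/strict_rderivable[]].
apply/within_openP => // p Wp; apply: (continuous_at_eq oW _ Wp (DP p v Wp).2).
by move=> q; rewrite inE => /(DP q v)[/strict_rderivable[]].
Qed.

Lemma C1_congr W f g : open W -> {in W, f =1 g} -> C1_on id W g -> C1_on id W f.
Proof.
move=> oW fg /(C1_strictP _ oW)[D DP]; apply/C1_strictP => //; exists D => p v Wp.
by have [gD cD] := DP p v Wp; split => //; exact: (strict_congr oW fg Wp gD).
Qed.

Lemma strict_add f g p v D E : strict_rderive f p v D -> strict_rderive g p v E ->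
  strict_rderive (fun z => f z + g z) p v (D + E).
Proof.
move=> fD gE eps eps0; have e2 : 0 < eps / 2 by rewrite divr_gt0.
have [[B C] /= [pB C0] BC] := fD _ e2.
have [[B' C'] /= [pB' C0'] BC'] := gE _ e2.
exists (B `&` B', C `&` C') => /=; first by split; apply: filterI.
move=> [q t] /= [[qB qB'] [tC tC']].
have := BC (q, t) (conj qB tC); have := BC' (q, t) (conj qB' tC').
rewrite /= => H1 H2.
have -> : eps * `|t| = eps / 2 * `|t| + eps / 2 * `|t| by field.
apply: le_trans (lerD H1 H2); apply: le_trans (ler_normD _ _).
by rewrite le_eqVlt; apply/orP; left; apply/eqP; congr `|_|; ring.
Qed.

Lemma strict_scale f p v D (c : R) : strict_rderive f p v D ->
  strict_rderive (fun z => c * f z) p v (c * D).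
Proof.
move=> fD eps eps0.
have e2 : 0 < eps / (1 + `|c|) by rewrite divr_gt0 // ltr_pwDl.
have := fD _ e2; apply: filterS => -[q t] /=.
have -> : c * f (q + t%:C *: v) - c * f q - t * (c * D) =
  c * (f (q + t%:C *: v) - f q - t * D) by ring.
rewrite normrM => H; apply: le_trans (ler_wpM2l (normr_ge0 c) H) _.
rewrite mulrA ler_wpM2r // mulrCA ler_piMr ?(ltW eps0) //.
by rewrite ler_pdivrMr ?ltr_pwDl // mul1r lerDr.
Qed.

Lemma C1_add W f g : open W -> C1_on id W f -> C1_on id W g ->
  C1_on id W (fun z => f z + g z).
Proof.
move=> oW /(C1_strictP _ oW)[D DP] /(C1_strictP _ oW)[E EP].
apply/C1_strictP => //; exists (fun v z => D v z + E v z) => p v Wp.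
have [fD cD] := DP p v Wp; have [gE cE] := EP p v Wp.
by split; [exact: strict_add|exact: cvgD].
Qed.

Lemma C1_scale W f (c : R) : open W -> C1_on id W f -> C1_on id W (fun z => c * f z).
Proof.
move=> oW /(C1_strictP _ oW)[D DP].
apply/C1_strictP => //; exists (fun v z => c * D v z) => p v Wp.
have [fD cD] := DP p v Wp; split; first exact: strict_scale.
by apply: cvgM => //; exact: cvg_cst.
Qed.

Lemma rderive_add W f g v p : open W -> C1_on id W f -> C1_on id W g -> W p ->
  rderive v (fun z => f z + g z) p = rderive v f p + rderive v g p.
Proof.
move=> oW fC gC Wp.
by have [] := strict_rderivable (strict_add (C1_strict v oW fC Wp) (C1_strict v oW gC Wp)).
Qed.

Lemma rderive_scale W f v (c : R) p : open W -> C1_on id W f -> W p ->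
  rderive v (fun z => c * f z) p = c * rderive v f p.
Proof.
by move=> oW fC Wp; have [] := strict_rderivable (strict_scale c (C1_strict v oW fC Wp)).
Qed.

Lemma C2_add W f g : open W -> C2_on id W f -> C2_on id W g ->
  C2_on id W (fun z => f z + g z).
Proof.
move=> oW [fC f2C] [gC g2C]; split; first exact: C1_add.
(* The formula for the first derivative is known only on [W], so it is transported by agreement on
   an open set rather than by equality of functions. *)
move=> v; apply: (@C1_congr W _ (fun z => rderive v f z + rderive v g z)) => //.
  by move=> q; rewrite inE => Wq; exact: rderive_add Wq.
exact: C1_add (f2C v) (g2C v).
Qed.

Lemma C2_scale W f (c : R) : open W -> C2_on id W f -> C2_on id W (fun z => c * f z).
Proof.
move=> oW [fC f2C]; split; first exact: C1_scale.
move=> v; apply: (@C1_congr W _ (fun z => c * rderive v f z)) => //.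
  by move=> q; rewrite inE => Wq; exact: rderive_scale Wq.
exact: C1_scale (f2C v).
Qed.

Lemma rderive_congr W f g v p : open W -> {in W, f =1 g} -> C1_on id W g -> W p ->
  rderive v f p = rderive v g p.
Proof.
move=> oW fg gC Wp.
by have [] := strict_rderivable (strict_congr oW fg Wp (C1_strict v oW gC Wp)).
Qed.

Lemma C1_sum W (I : finType) (f : I -> V -> R) : open W ->
  (forall i, C1_on id W (f i)) -> C1_on id W (fun z => \sum_i f i z).
Proof.
move=> oW fC; rewrite (_ : (fun z => _) = \sum_i f i); last first.
  by apply/funext => z; rewrite fct_sumE.
apply: (big_ind (fun g => C1_on id W g)) => //; last by move=> f1 g1; exact: C1_add.
apply/C1_strictP => //; exists (fun _ _ => 0) => p v Wp; split; last exact: cvg_cst.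
move=> eps eps0; have : \forall q \near p & t \near (0 : R), True by exact: filterT.
apply: filterS => -[q t] _ /=; rewrite [in X in `|X|]/GRing.zero /= subrr mulr0 subrr normr0.
by rewrite mulr_ge0 // ltW.
Qed.

Lemma C2_span (I : finType) (e : I -> V) W f :
  (forall v, exists c : I -> R, v = \sum_i (c i)%:C *: e i) ->
  open W -> C2_on e W f -> C2_on id W f.
Proof.
move=> span oW [fC f2C]; split; first exact: C1_span fC.
move=> v; have [c ->] := span v.
apply: (@C1_congr W _ (fun p => \sum_i c i * rderive (e i) f p)) => //.
  by move=> p; rewrite inE => /(C1_span_rderive c oW fC)/strict_rderivable[].
by apply: C1_sum => // i; apply: C1_scale => //; exact: C1_span (f2C i).
Qed.

(** * Symmetry of second derivatives *)

Lemma near_parallelogram p v w (A : set V) : nbhs p A ->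
  exists2 t : R, 0 < t & forall c d : R, `|c| <= t -> `|d| <= t ->
    A (p + c%:C *: v + d%:C *: w).
Proof.
move=> pA; have [[B C] /= [pB C0] BC] := near_segment w pA.
have [[B' C'] /= [pB' C0'] BC'] := near_segment v pB.
have /(@nbhs_normP R R)[r /= r0 rC] : nbhs (0 : R) (C `&` C') by exact: filterI.
have r2 : ball_ Num.Def.normr 0 r (r / 2).
  by rewrite /= sub0r normrN ger0_norm ?ltr_pdivrMr ?divr_ge0 ?ltW ?ltr_pMr ?ltr1n.
have r20 : 0 < r / 2 by rewrite divr_gt0.
exists (r / 2) => // c d cr dr; have [Cr C'r] := rC _ r2.
have nr : `|r / 2| = r / 2 by rewrite ger0_norm ?ltW.
apply: (BC (_, r / 2)) => /=; last by rewrite nr.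
split => //=; apply: (BC' (p, r / 2)) => /=; last by rewrite nr.
by split => //; exact: nbhs_singleton.
Qed.

(** Two mean value theorems: first along [v] for the difference of [f] on two opposite sides of the
    parallelogram, then along [w] for [rderive v f]. *)
Lemma second_difference W f p v w (t : R) : open W -> C2_on id W f -> 0 < t ->
  (forall c d : R, `|c| <= t -> `|d| <= t -> W (p + c%:C *: v + d%:C *: w)) ->
  exists c d : R, [/\ `|c| <= t, `|d| <= t &
    f (p + t%:C *: v + t%:C *: w) - f (p + t%:C *: v) - (f (p + t%:C *: w) - f p) =
      rderive w (rderive v f) (p + c%:C *: v + d%:C *: w) * t * t].
Proof.
move=> oW [fC f2C] t0 pW; have tt : `|t| = t by rewrite gtr0_norm.
have dd (s : R) : 0 <= s -> s <= t -> is_derive s 1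
    (fun s : R => f (p + t%:C *: w + s%:C *: v) - f (p + s%:C *: v))
    (rderive v f (p + t%:C *: w + s%:C *: v) - rderive v f (p + s%:C *: v)).
  move=> s0 st; have sn : `|s| <= t by rewrite ger0_norm.
  apply: is_deriveB; apply: is_derive_line; apply: (fC v).1.
    by rewrite addrAC; apply: pW => //; rewrite tt.
  by have := pW s 0 sn; rewrite normr0 scale0r addr0; apply; exact: ltW.
have [] := @MVT R
  (fun s => f (p + t%:C *: w + s%:C *: v) - f (p + s%:C *: v))
  (fun s => rderive v f (p + t%:C *: w + s%:C *: v) - rderive v f (p + s%:C *: v))
  0 t t0.
- move=> s; rewrite in_itv /= => /andP[s0 st]; exact: dd s (ltW s0) (ltW st).
- apply: derivable_within_continuous => s; rewrite in_itv /= => /andP[s0 st].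
  by have [] := dd s s0 st.
move=> c; rewrite in_itv /= subr0 scale0r !addr0 => /andP[c0 ct] E.
have cn : `|c| <= t by rewrite gtr0_norm // ltW.
have [|d] := @line_MVT (rderive v f) (p + c%:C *: v) w t.
  by move=> s; rewrite tt => st; apply: (f2C v w).1; exact: pW.
rewrite tt => dt E'; exists c, d; split => //.
by rewrite -E' -(addrAC p (t%:C *: w) (c%:C *: v)) -E (addrAC p (t%:C *: w)).
Qed.

(** The second difference is symmetric in [v] and [w], so each mixed derivative, taken at a suitable
    point of a small parallelogram, equals the same quotient. If the two differed by [e > 0] at [p],
    keeping each within [e / 2] of its value at [p] would give [e < e]. *)
Lemma C2_symmetric W f p v w : open W -> C2_on id W f -> W p ->
  rderive w (rderive v f) p = rderive v (rderive w f) p.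
Proof.
move=> oW fC2 Wp; have regroup (a b c d : R) : a - b - (c - d) = a - c - (b - d) by ring.
apply/eqP/negP => /negP; rewrite -subr_eq0 -normr_gt0.
set e := `|_| => e0; have [_ f2C] := fC2.
have cont v' w' : {for p, continuous (rderive w' (rderive v' f))}.
  by have [_ /(within_openP _ oW)] := f2C v' w'; apply.
have near v' w' : nbhs p
    [set q | `|rderive w' (rderive v' f) p - rderive w' (rderive v' f) q| < e / 2].
  by have /cvgrPdist_lt := cont v' w'; apply; rewrite divr_gt0.
have /(near_parallelogram v w)[t t0 tW] :
    nbhs p (W `&` ([set q | `|rderive w (rderive v f) p - rderive w (rderive v f) q| < e / 2]
      `&` [set q | `|rderive v (rderive w f) p - rderive v (rderive w f) q| < e / 2])).
  by apply: filterI; [exact: open_nbhs_nbhs|exact: filterI].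
have [|c [d [ct dt E1]]] := @second_difference W f p v w t oW fC2 t0.
  by move=> c d ct dt; have [] := tW c d ct dt.
have [|c' [d' [ct' dt' E2]]] := @second_difference W f p w v t oW fC2 t0.
  by move=> c' d' ct' dt'; rewrite addrAC; have [] := tW d' c' dt' ct'.
have [_ [/= H1 _]] := tW c d ct dt; have [_ [/= _ H2]] := tW d' c' dt' ct'.
have E : rderive w (rderive v f) (p + c%:C *: v + d%:C *: w) =
         rderive v (rderive w f) (p + d'%:C *: v + c'%:C *: w).
  apply: (mulIf (lt0r_neq0 t0)); apply: (mulIf (lt0r_neq0 t0)).
  apply: etrans (esym E1) _; rewrite (addrAC p (d'%:C *: v)); apply: etrans E2.
  by rewrite (addrAC p (t%:C *: w)); exact: regroup.
have : e < e / 2 + e / 2.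
  rewrite -E distrC in H2; apply: le_lt_trans (ltrD H1 H2).
  apply: le_trans (ler_normD _ _); rewrite le_eqVlt; apply/orP; left; apply/eqP.
  by rewrite /e addrA subrK.
by rewrite -splitr ltxx.
Qed.

(** * Continuity of C^1 functions and the second-order Taylor formula *)

Lemma near_center_segment p (A : set V) : nbhs p A ->
  \forall q \near p, forall s : R, `|s| <= 1 -> A (p + s%:C *: (q - p)).
Proof.
move=> /nbhs_realP[r r0 rA]; apply/nbhs_realP; exists r => // q qr s s1.
apply: rA; rewrite addrAC subrr add0r normrZ normC_real.
by apply: le_lt_trans qr; rewrite ler_piMl // lecR.
Qed.

Lemma C1_continuous_at (I : finType) (e : I -> V) (c : I -> V -> R) W f p :
  (forall v, v = \sum_i (c i v)%:C *: e i) -> (forall i, c i 0 = 0) ->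
  (forall i, {for 0, continuous (c i)}) ->
  open W -> C1_on id W f -> W p -> {for p, continuous f}.
Proof.
move=> span c0 cc oW fC Wp; apply/cvgrPdist_le => eps eps0.
have cvg_sub : (fun q => q - p) @ p --> (0 : V).
  by rewrite -[X in _ --> X](subrr p); apply: cvgB; [exact: cvg_id|exact: cvg_cst].
(* [K q] dominates the increment: that increment is the derivative along [q - p] at some
   [p + s (q - p)], it expands in the finite frame, and near [p] each partial derivative exceeds its
   size at [p] by at most 1. *)
pose K q := \sum_i `|c i (q - p)| * (`|rderive (e i) f p| + 1).
have K0 : {for p, continuous K}.
  apply: continuous_at_sum => i; apply: cvgM; last exact: cvg_cst.
  by apply: cvg_norm; rewrite subrr; exact: (cvg_comp _ _ cvg_sub (cc i)).
have Ksmall : \forall q \near p, `|K p - K q| <= eps by move/cvgrPdist_le : K0; apply.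
have Kp : K p = 0 by rewrite /K big1 // => i _; rewrite subrr c0 normr0 mul0r.
have dbound : nbhs p [set q | forall i, `|rderive (e i) f q| <= `|rderive (e i) f p| + 1].
  apply: filter_forall => i.
  have [_ /(within_openP _ oW)/(_ p Wp)/cvgrPdist_le/(_ 1 ltr01)] := fC (e i).
  apply: filterS => q H; rewrite -lerBlDl; apply: le_trans H.
  by rewrite distrC; apply: le_trans (lerB_dist _ _) _; rewrite distrC.
have nW : nbhs p W by exact: open_nbhs_nbhs.
have nWd : nbhs p (W `&` [set q | forall i, `|rderive (e i) f q| <= `|rderive (e i) f p| + 1]).
  exact: filterI.
have nS := near_center_segment nWd; apply: filterS2 Ksmall nS => q.
rewrite Kp sub0r normrN => Kq H.
have [|s] := @line_MVT f p (q - p) 1.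
  by move=> s; rewrite normr1 => s1; apply: (fC _).1; have [] := H s s1.
rewrite normr1 scale1r mulr1 (addrC p) subrK => s1; rewrite distrC => ->.
have [Ws ds] := H s s1.
rewrite [in X in rderive X](span (q - p)) (C1_rderive_sum _ oW fC Ws).
apply: le_trans (le_trans (ler_norm _) Kq); apply: le_trans (ler_norm_sum _ _ _) _.
by apply: ler_sum => i _; rewrite (C1_rderiveZ _ _ oW fC Ws) normrM ler_wpM2l.
Qed.

(** [K] is chosen so that the auxiliary [g] takes equal values at 0 and 1. A zero [c] of its
    derivative, and the mean value theorem for [rderive w f] between 0 and [c], then identify a
    second derivative with [2 K]. *)
Lemma taylor2 W f p w : open W -> C2_on id W f ->
  (forall s : R, `|s| <= 1 -> W (p + s%:C *: w)) ->
  exists2 s : R, `|s| <= 1 &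
    f (p + w) = f p + rderive w f p + rderive w (rderive w f) (p + s%:C *: w) / 2.
Proof.
move=> oW [fC f2C] pW.
pose K := f (p + w) - f p - rderive w f p.
pose g (s : R) := f (p + s%:C *: w) - (s * rderive w f p + s ^+ 2 * K).
have dg (s : R) : 0 <= s <= 1 -> is_derive s 1 g
    (rderive w f (p + s%:C *: w) - (rderive w f p + 2 * s * K)).
  move=> /andP[s0 s1]; apply: is_deriveB.
    by apply: is_derive_line; apply: (fC w).1; apply: pW; rewrite ger0_norm.
  apply: is_derive_eq; rewrite /= !scaler0 !add0r /GRing.scale /=; ring.
have [] := @MVT R g
  (fun s => rderive w f (p + s%:C *: w) - (rderive w f p + 2 * s * K)) 0 1 ltr01.
- by move=> s; rewrite in_itv /= => /andP[s0 s1]; apply: dg; rewrite !ltW.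
- apply: derivable_within_continuous => s; rewrite in_itv /= => s01.
  by have [] := dg s s01.
move=> c; rewrite in_itv /= => /andP[c0 c1]; rewrite subr0 mulr1.
rewrite /g scale0r scale1r addr0 mul0r expr0n mul0r expr1n !mul1r addr0 => E.
have [|d] := @line_MVT (rderive w f) p w c.
  move=> s sc; apply: (f2C w w).1; apply: pW; apply: le_trans sc _.
  by rewrite gtr0_norm // ltW.
rewrite (gtr0_norm c0) => dc E'; exists d; first by rewrite (le_trans dc) // ltW.
have E2 : rderive w (rderive w f) (p + d%:C *: w) = 2 * K.
  by apply: (mulIf (lt0r_neq0 c0)); rewrite -E'; move: E; rewrite /K; lra.
by rewrite E2 /K; field.
Qed.

Lemma rderive_quadratic f p v (c1 c2 : R) :
  (forall t : R, f (p + t%:C *: v) = f p + (t * c1 + t ^+ 2 * c2)) ->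
  rderivable f p v /\ rderive v f p = c1.
Proof.
move=> H; have E : (fun t : R => f (p + t%:C *: v)) = (fun t => f p + (t * c1 + t ^+ 2 * c2)).
  exact/funext.
have : is_derive (0 : R) 1 (fun t : R => f p + (t * c1 + t ^+ 2 * c2)) c1.
  by apply: is_derive_eq; rewrite /= !scaler0 /GRing.scale /=; ring.
rewrite -E => -[d e]; split; first exact: d.
by rewrite /rderive derive1E.
Qed.

End RealLines.

(** * Arithmetic of continuity at a point *)

Section ContinuousAt.
Context {R : realType} {T : topologicalType}.
Implicit Types (f g : T -> R) (p : T).

Lemma continuous_at_cst (c : R) p : continuous_at p (fun _ : T => c).
Proof. exact: cvg_cst. Qed.

Lemma continuous_at_add f g p : continuous_at p f -> continuous_at p g ->
  continuous_at p (fun z => f z + g z).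
Proof. by move=> cf cg; exact: cvgD. Qed.

Lemma continuous_at_sub f g p : continuous_at p f -> continuous_at p g ->
  continuous_at p (fun z => f z - g z).
Proof. by move=> cf cg; exact: cvgB. Qed.

Lemma continuous_at_mul f g p : continuous_at p f -> continuous_at p g ->
  continuous_at p (fun z => f z * g z).
Proof. by move=> cf cg; exact: cvgM. Qed.

End ContinuousAt.

(** * Harmonic quadratic polynomials in the plane *)

Section Plane.
Context {R : realType}.
Implicit Types (z : R[i]) (W : set R[i]).

Lemma normr_normc z : `|z| = (Normc.normc z)%:C.
Proof. by case: z. Qed.

Lemma Re_le_normc z : `|complex.Re z| <= Normc.normc z.
Proof. by case: z => x y /=; rewrite -sqrtr_sqr ler_wsqrtr // lerDl sqr_ge0. Qed.

Lemma Im_le_normc z : `|complex.Im z| <= Normc.normc z.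
Proof. by case: z => x y /=; rewrite -sqrtr_sqr ler_wsqrtr // lerDr sqr_ge0. Qed.

Lemma normc_sqr z : Normc.normc z ^+ 2 = complex.Re z ^+ 2 + complex.Im z ^+ 2.
Proof. by case: z => x y /=; rewrite sqr_sqrtr // addr_ge0 // sqr_ge0. Qed.

Lemma continuous_Re : continuous (fun z : R[i] => complex.Re z).
Proof.
move=> z; apply/(@cvgrPdist_lt _ R _ (nbhs z)) => e e0; apply/nbhs_realP; exists e => // w.
rewrite normr_normc ltcR distrC -raddfB; exact: le_lt_trans (Re_le_normc _).
Qed.

Lemma continuous_Im : continuous (fun z : R[i] => complex.Im z).
Proof.
move=> z; apply/(@cvgrPdist_lt _ R _ (nbhs z)) => e e0; apply/nbhs_realP; exists e => // w.
rewrite normr_normc ltcR distrC -raddfB; exact: le_lt_trans (Im_le_normc _).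
Qed.

Lemma rderive_affine (c al be : R) z :
  let l z := c + (al * complex.Re z + be * complex.Im z) in
  forall b, rderivable l z (frameC b) /\ rderive (frameC b) l z = if b then be else al.
Proof.
move=> l b; apply: (@rderive_quadratic _ _ _ _ _ _ 0) => t.
by case: b; case: z => x y; rewrite /l /= ?scaler0 /GRing.scale /=; ring.
Qed.

Lemma continuous_affine (c al be : R) :
  continuous (fun z : R[i] => c + (al * complex.Re z + be * complex.Im z)).
Proof.
move=> z; apply: continuous_at_add; first exact: continuous_at_cst.
apply: continuous_at_add; apply: continuous_at_mul; try exact: continuous_at_cst.
  exact: continuous_Re.
exact: continuous_Im.
Qed.

(** This is c + Re ((b1 - i b2 / 2) z^2), the general real harmonic polynomial of degree at most 2
    without linear term. *)
Definition quadratic (c b1 b2 : R) z : R :=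
  c + (b1 * (complex.Re z ^+ 2 - complex.Im z ^+ 2) + b2 * (complex.Re z * complex.Im z)).

Lemma rderive_harmonic_quadratic (c b1 b2 : R) b z :
  rderivable (quadratic c b1 b2) z (frameC b) /\
  rderive (frameC b) (quadratic c b1 b2) z =
    0 + ((if b then b2 else 2 * b1) * complex.Re z +
         (if b then - (2 * b1) else b2) * complex.Im z).
Proof.
apply: (@rderive_quadratic _ _ _ _ _ _ (if b then - b1 else b1)) => t.
by case: b; case: z => x y; rewrite /quadratic /= ?scaler0 /GRing.scale /=; ring.
Qed.

Lemma harmonic_quadratic W (c b1 b2 : R) : harmonic_on W (quadratic c b1 b2).
Proof.
have E b : rderive (frameC b) (quadratic c b1 b2) =
    (fun z => 0 + ((if b then b2 else 2 * b1) * complex.Re z +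
                   (if b then - (2 * b1) else b2) * complex.Im z)).
  by apply/funext => z; rewrite (rderive_harmonic_quadratic c b1 b2 b z).2.
split; last first.
  move=> z _; rewrite -[1]/(frameC false) -[imC]/(frameC true) !E.
  by rewrite (rderive_affine _ _ _ _ false).2 (rderive_affine _ _ _ _ true).2 subrr.
split=> b.
  split=> [z _|]; first exact: (rderive_harmonic_quadratic c b1 b2 b z).1.
  by rewrite E; apply: continuous_subspaceT; exact: continuous_affine.
rewrite E => b'; split=> [z _|]; first exact: (rderive_affine _ _ _ _ b').1.
rewrite (_ : rderive _ _ =
    fun=> if b' then (if b then - (2 * b1) else b2) else (if b then b2 else 2 * b1)).
  by apply: continuous_subspaceT => z; exact: continuous_at_cst.
by apply/funext => z; rewrite (rderive_affine _ _ _ _ b').2.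
Qed.

Lemma continuous_quadratic (c b1 b2 : R) : continuous (quadratic c b1 b2).
Proof.
move=> z; have cr := @continuous_Re z; have ci := @continuous_Im z.
apply: continuous_at_add; first exact: continuous_at_cst.
apply: continuous_at_add; apply: continuous_at_mul; try exact: continuous_at_cst.
  by apply: continuous_at_sub; apply: continuous_at_mul.
exact: continuous_at_mul.
Qed.

(** The harmonic majorant is evaluated at the centre, where it equals [c]. This takes the place of a
    sub-mean value inequality. *)
Lemma subharmonic_center_le W (F : R[i] -> R) (r c b1 b2 : R) :
  subharmonic W (fun z => (F z)%:E) -> 0 < r -> closed_disc 0 r `<=` W ->
  (forall z, circle 0 r z -> F z <= quadratic c b1 b2 z) -> F 0 <= c.
Proof.
move=> [_ sF] r0 rW Fq.
have := sF 0 r r0 rW (quadratic c b1 b2).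
rewrite /quadratic; move=> H; have := H _ (harmonic_quadratic _ _ _ _) _ 0.
rewrite /= expr0n /= subrr !mulr0 !addr0 lee_fin; apply.
- by apply: continuous_subspaceT; exact: continuous_quadratic.
- by move=> z /Fq; rewrite lee_fin.
- by have : Normc.normc (0 - 0 : R[i]) < r by rewrite subr0 (Normc.normc0 R).
Qed.

End Plane.

(** * Real coordinates on C^n and the real form of the Levi condition *)

Section ComplexSpace.
Context {R : realType} {n : nat}.
Local Notation Cn := 'rV[R[i]]_n.
Implicit Types (a p d v w : Cn) (f g : Cn -> R) (W : set Cn).

Definition coordCn (j : 'I_n * bool) d : R :=
  if j.2 then complex.Im (d ord0 j.1) else complex.Re (d ord0 j.1).

Lemma sum_pair_bool (A : nmodType) (F : 'I_n * bool -> A) :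
  \sum_j F j = \sum_j (F (j, false) + F (j, true)).
Proof.
rewrite (eq_bigr (fun j => F (j.1, j.2))); last by case.
rewrite -(pair_bigA _ (fun j b => F (j, b))) /=.
by apply: eq_bigr => j _; rewrite big_bool addrC.
Qed.

Lemma frameCn_span d : d = \sum_j (coordCn j d)%:C *: frameCn j.
Proof.
rewrite sum_pair_bool; apply/rowP => k; rewrite summxE (bigD1 k) //= big1.
  rewrite /frameCn /coordCn /unit_x /unit_y /imC /= !mxE !eqxx /=.
  by case: (d ord0 k) => x y; apply/eqP; rewrite eq_complex /=; apply/andP; split; apply/eqP; ring.
move=> j jk; rewrite /frameCn /unit_x /unit_y /= !mxE eqxx /= eq_sym (negbTE jk).
by rewrite !mulr0 addr0.
Qed.

Lemma continuous_coordCn j : continuous (coordCn j).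
Proof.
case: j => j b p; rewrite /coordCn /=.
have cj : (fun q : Cn => q ord0 j) @ p --> p ord0 j by exact: coord_continuous.
by case: b; apply: (cvg_comp _ _ cj); [exact: continuous_Im|exact: continuous_Re].
Qed.

Lemma C2_frameCn W f : open W -> C2_on frameCn W f -> C2_on id W f.
Proof. by apply: C2_span => v; exists (coordCn^~ v); exact: frameCn_span. Qed.

Lemma C1_continuousCn W f p : open W -> C1_on id W f -> W p -> {for p, continuous f}.
Proof.
apply: (C1_continuous_at frameCn_span) => j; last exact: continuous_coordCn.
by case: j => j [] /=; rewrite /coordCn /= mxE.
Qed.

Definition hess f p v w : R := rderive w (rderive v f) p.

(** For C^2 functions, the Laplacian at z = 0 of the restriction z -> f (p + z d) to a complex
    line. *)
Definition laplacian f p d : R := hess f p d d + hess f p (imC *: d) (imC *: d).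

Definition combCn (x y : 'I_n -> R) : Cn :=
  \sum_j ((x j)%:C *: unit_x j + (y j)%:C *: unit_y j).

Lemma combCn_coord d :
  d = combCn (fun j => complex.Re (d ord0 j)) (fun j => complex.Im (d ord0 j)).
Proof. by rewrite {1}(frameCn_span d) sum_pair_bool. Qed.

Lemma imC_combCn d :
  imC *: d = combCn (fun j => - complex.Im (d ord0 j)) (fun j => complex.Re (d ord0 j)).
Proof.
rewrite {1}[imC *: d]combCn_coord; congr combCn; apply/funext => j; rewrite !mxE;
  by case: (d ord0 j) => x y /=; ring.
Qed.

Lemma C1_rderive_combCn W f p (x y : 'I_n -> R) : open W -> C1_on id W f -> W p ->
  rderive (combCn x y) f p =
    \sum_j (x j * rderive (unit_x j) f p + y j * rderive (unit_y j) f p).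
Proof.
move=> oW fC Wp; rewrite (C1_rderive_sum _ oW fC Wp); apply: eq_bigr => j _.
by rewrite (C1_rderiveD _ _ oW fC Wp) !(C1_rderiveZ _ _ oW fC Wp).
Qed.

Lemma hess_sym W f p v w : open W -> C2_on id W f -> W p ->
  hess f p v w = hess f p w v.
Proof. exact: C2_symmetric. Qed.

Lemma hess_combCnr W f p v (x y : 'I_n -> R) : open W -> C2_on id W f -> W p ->
  hess f p v (combCn x y) =
    \sum_j (x j * hess f p v (unit_x j) + y j * hess f p v (unit_y j)).
Proof. by move=> oW [_ f2C]; exact: C1_rderive_combCn. Qed.

Lemma hess_combCn W f p (x y x' y' : 'I_n -> R) : open W -> C2_on id W f -> W p ->
  hess f p (combCn x y) (combCn x' y') =
    \sum_j \sum_k (x j * x' k * hess f p (unit_x j) (unit_x k)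
      + x j * y' k * hess f p (unit_x j) (unit_y k)
      + y j * x' k * hess f p (unit_y j) (unit_x k)
      + y j * y' k * hess f p (unit_y j) (unit_y k)).
Proof.
move=> oW fC2 Wp; rewrite (hess_sym _ _ oW fC2 Wp) (hess_combCnr _ _ _ oW fC2 Wp).
apply: eq_bigr => j _.
rewrite (hess_sym _ (unit_x j) oW fC2 Wp) (hess_sym _ (unit_y j) oW fC2 Wp).
rewrite (hess_combCnr (unit_x j) _ _ oW fC2 Wp) (hess_combCnr (unit_y j) _ _ oW fC2 Wp).
rewrite !mulr_sumr -big_split /=; apply: eq_bigr => k _.
by move: (hess _ _ _ _) (hess _ _ _ _) (hess _ _ _ _) (hess _ _ _ _) => *; ring.
Qed.

Lemma rderive_cst v (c : R) p : rderive v (fun _ : Cn => c) p = 0.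
Proof. by rewrite /rderive derive1_cst. Qed.

Lemma cderive_real v f p : cderive v (fun z => (f z)%:C) p = (rderive v f p)%:C.
Proof. by rewrite /cderive /= (rderive_cst v 0). Qed.

Lemma wirtingerE j f p : wirtinger j (fun z => (f z)%:C) p =
  (rderive (unit_x j) f p / 2) +i* (- (rderive (unit_y j) f p / 2)).
Proof.
rewrite /wirtinger !cderive_real; move: (rderive _ _ _) (rderive _ _ _) => x y.
rewrite /imC (_ : 2%:R^-1 = (2^-1)%:C); last by rewrite fmorphV rmorph_nat.
by apply/eqP; rewrite eq_complex /=; apply/andP; split; apply/eqP; field.
Qed.

Lemma wirtinger_barE j f : wirtinger_bar j (fun z => (f z)%:C) =
  fun p => (2^-1 * rderive (unit_x j) f p) +i* (2^-1 * rderive (unit_y j) f p).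
Proof.
apply/funext => p.
rewrite /wirtinger_bar !cderive_real; move: (rderive _ _ _) (rderive _ _ _) => x y.
rewrite /imC (_ : 2%:R^-1 = (2^-1)%:C); last by rewrite fmorphV rmorph_nat.
by apply/eqP; rewrite eq_complex /=; apply/andP; split; apply/eqP; field.
Qed.

Lemma wirtinger_parts j (P Q : Cn -> R) p :
  wirtinger j (fun q => P q +i* Q q) p =
    ((rderive (unit_x j) P p + rderive (unit_y j) Q p) / 2)
    +i* ((rderive (unit_x j) Q p - rderive (unit_y j) P p) / 2).
Proof.
rewrite /wirtinger /cderive /=.
move: (rderive _ P _) (rderive _ P _) (rderive _ Q _) (rderive _ Q _) => x y z t.
rewrite /imC (_ : 2%:R^-1 = (2^-1)%:C); last by rewrite fmorphV rmorph_nat.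
by apply/eqP; rewrite eq_complex /=; apply/andP; split; apply/eqP; field.
Qed.

Lemma wirtinger2E W j k f p : open W -> C2_on id W f -> W p ->
  wirtinger j (wirtinger_bar k (fun z => (f z)%:C)) p =
    ((hess f p (unit_x j) (unit_x k) + hess f p (unit_y j) (unit_y k)) / 4)
    +i* ((hess f p (unit_x j) (unit_y k) - hess f p (unit_y j) (unit_x k)) / 4).
Proof.
move=> oW fC2 Wp; have [_ f2C] := fC2; rewrite wirtinger_barE wirtinger_parts.
have sc v w : rderive w (fun q => 2^-1 * rderive v f q) p = 2^-1 * hess f p w v.
  by rewrite (hess_sym _ _ oW fC2 Wp); exact: rderive_scale (f2C v) Wp.
have half (x y : R) : (2^-1 * x + 2^-1 * y) / 2 = (x + y) / 4 by field.
have halfN (x y : R) : (2^-1 * x - 2^-1 * y) / 2 = (x - y) / 4 by field.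
apply: f_equal2; first by apply: etrans (half _ _); do 2?apply: f_equal2.
by apply: etrans (halfN _ _); apply: f_equal2 => //; apply: f_equal2 => //; apply: f_equal.
Qed.

(** In real coordinates the real parts match the two Hessian terms summand by summand. The imaginary
    parts [T j k] are antisymmetric, because the Hessian is symmetric, so their sum equals its own
    negative. *)
Lemma levi_formE W f p d : open W -> C2_on id W f -> W p ->
  levi_form f p d = (laplacian f p d / 4)%:C.
Proof.
move=> oW fC2 Wp; pose a j := complex.Re (d ord0 j); pose b j := complex.Im (d ord0 j).
pose H := hess f p.
have Hsym v w : H v w = H w v by exact: hess_sym fC2 Wp.
pose X j k := (H (unit_x j) (unit_x k) + H (unit_y j) (unit_y k)) / 4.
pose Y j k := (H (unit_x j) (unit_y k) - H (unit_y j) (unit_x k)) / 4.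
have termE j k : wirtinger j (wirtinger_bar k (fun z => (f z)%:C)) p * d ord0 j * conjc (d ord0 k) =
   (X j k * (a j * a k + b j * b k) - Y j k * (b j * a k - a j * b k)) +i*
   (X j k * (b j * a k - a j * b k) + Y j k * (a j * a k + b j * b k)).
  rewrite (wirtinger2E _ _ oW fC2 Wp) -/H -/(X j k) -/(Y j k) /a /b.
  case: (d ord0 j) (d ord0 k) => x y [z t] /=; move: (X j k) (Y j k) => X0 Y0.
  by apply/eqP; rewrite eq_complex /=; apply/andP; split; apply/eqP; ring.
rewrite /levi_form; under eq_bigr do under eq_bigr do rewrite termE.
apply/eqP; rewrite eq_complex; apply/andP; split; apply/eqP => /=.
  rewrite raddf_sum /laplacian [imC *: d]imC_combCn {1 2}[d]combCn_coord.
  rewrite !(hess_combCn _ _ _ _ oW fC2 Wp) -big_split mulr_suml /=.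
  apply: eq_bigr => j _; rewrite raddf_sum -big_split mulr_suml /=.
  apply: eq_bigr => k _; rewrite /X /Y -/H /a /b.
  by move: (H _ _) (H _ _) (H _ _) (H _ _) => *; field.
rewrite raddf_sum /=; under eq_bigr do rewrite raddf_sum /=.
set T := fun j k : 'I_n => X j k * (b j * a k - a j * b k) + Y j k * (a j * a k + b j * b k).
have Tanti j k : T j k = - T k j.
  rewrite /T /X /Y (Hsym (unit_x k) (unit_x j)) (Hsym (unit_y k) (unit_y j)).
  rewrite (Hsym (unit_x k) (unit_y j)) (Hsym (unit_y k) (unit_x j)).
  by move: (H _ _) (H _ _) (H _ _) (H _ _) => *; field.
have : \sum_j \sum_k T j k = - \sum_j \sum_k T j k.
  rewrite {1}exchange_big /= -sumrN; apply: eq_bigr => j _.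
  by rewrite -sumrN; apply: eq_bigr => k _; exact: Tanti.
by rewrite -/T; lra.
Qed.

(** The defining sum is half of D_d f - i D_(id) f, so one complex equation amounts to two real
    ones. *)
Lemma complex_tangentP W f p d : open W -> C1_on id W f -> W p ->
  complex_tangent f p d <-> rderive d f p = 0 /\ rderive (imC *: d) f p = 0.
Proof.
move=> oW fC Wp; rewrite /complex_tangent /=.
pose a j := complex.Re (d ord0 j); pose b j := complex.Im (d ord0 j).
have D1 : rderive d f p = \sum_j (a j * rderive (unit_x j) f p + b j * rderive (unit_y j) f p).
  by rewrite {1}[d]combCn_coord; exact: C1_rderive_combCn fC Wp.
have D2 : rderive (imC *: d) f p =
    \sum_j (- b j * rderive (unit_x j) f p + a j * rderive (unit_y j) f p).
  by rewrite [imC *: d]imC_combCn; exact: C1_rderive_combCn fC Wp.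
have E : \sum_(j < n) wirtinger j (fun z => (f z)%:C) p * d ord0 j =
    (rderive d f p / 2) +i* (- (rderive (imC *: d) f p / 2)).
  under eq_bigr do rewrite wirtingerE.
  rewrite D1 D2; apply/eqP; rewrite eq_complex; apply/andP; split; apply/eqP => /=;
    rewrite raddf_sum mulr_suml -?sumrN; apply: eq_bigr => j _; rewrite /a /b;
    move: (rderive _ _ _) (rderive _ _ _) => s t;
    by case: (d ord0 j) => x y /=; field.
rewrite E; move: (rderive d f p) (rderive (imC *: d) f p) => X Y; clear.
split=> [/eqP|[-> ->]]; last by rewrite mul0r oppr0.
by rewrite eq_complex /= => /andP[/eqP H1 /eqP H2]; split; lra.
Qed.

End ComplexSpace.

(** * Second-order behaviour along complex tangent lines *)

Section ComplexLines.
Context {R : realType} {n : nat}.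
Local Notation Cn := 'rV[R[i]]_n.
Implicit Types (a p d v w : Cn) (f g : Cn -> R) (W : set Cn).

Lemma complex_scaleE (z : R[i]) d :
  z *: d = (complex.Re z)%:C *: d + (complex.Im z)%:C *: (imC *: d).
Proof.
rewrite scalerA -scalerDl; congr (_ *: _); case: z => x y.
by apply/eqP; rewrite eq_complex /imC /=; apply/andP; split; apply/eqP; ring.
Qed.

Lemma near_disc p d (A : set Cn) : nbhs p A ->
  exists2 r : R, 0 < r & forall z, Normc.normc z <= r -> A (p + z *: d).
Proof.
move=> /nbhs_realP[r r0 rA].
have [c c0 dc] : exists2 c : R, 0 <= c & `|d| = c%:C.
  have := normr_ge0 d; case: (`|d|) => x y; rewrite lecE /= => /andP[/eqP -> x0].
  by exists x.
have c1 : 0 < c + 1 by rewrite ltr_wpDl.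
exists (r / (c + 1) / 2); first by rewrite !divr_gt0.
move=> z zr; apply: rA; rewrite addrAC subrr add0r normrZ normr_normc dc -realCM ltcR.
apply: le_lt_trans (ler_wpM2r c0 zr) _.
rewrite mulrAC ltr_pdivrMr // mulrAC ltr_pdivrMr //.
nra.
Qed.

Lemma hessD W f p (x y : R) v w : open W -> C2_on id W f -> W p ->
  hess f p (x%:C *: v + y%:C *: w) (x%:C *: v + y%:C *: w) =
    x ^+ 2 * hess f p v v + x * y * (hess f p v w + hess f p w v) + y ^+ 2 * hess f p w w.
Proof.
move=> oW fC2 Wp; have [fC f2C] := fC2.
have Dr u v' w' (s t : R) :
    hess f p u (s%:C *: v' + t%:C *: w') = s * hess f p u v' + t * hess f p u w'.
  by rewrite /hess (C1_rderiveD _ _ oW (f2C u) Wp) !(C1_rderiveZ _ _ oW (f2C u) Wp).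
have S v' w' : hess f p v' w' = hess f p w' v' by exact: hess_sym fC2 Wp.
rewrite Dr (S _ v) (S _ w) (Dr v) (Dr w).
by move: (hess _ _ _ _) (hess _ _ _ _) (hess _ _ _ _) (hess _ _ _ _) => *; ring.
Qed.

Lemma continuous_hess W f v w p : open W -> C2_on id W f -> W p ->
  continuous_at p (fun q => hess f q v w).
Proof. by move=> oW [_ f2C] Wp; have [_ /(within_openP _ oW)] := f2C v w; apply. Qed.

(** The form with coefficients [A], [B], [C], [D] is a harmonic part plus its trace part (A + D) / 4
    times x^2 + y^2. Perturbing the coefficients by less than [eps / 2] costs at most [eps] times
    x^2 + y^2. *)
Lemma quadratic_form_close (x y eps A A' B B' C C' D D' : R) : 0 < eps ->
  `|A - A'| < eps / 2 -> `|B - B'| < eps / 2 -> `|C - C'| < eps / 2 ->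
  `|D - D'| < eps / 2 ->
  (x ^+ 2 * A' + x * y * (B' + C') + y ^+ 2 * D') / 2 <=
    (A - D) / 4 * (x ^+ 2 - y ^+ 2) + (B + C) / 2 * (x * y)
      + ((A + D) / 4 + eps) * (x ^+ 2 + y ^+ 2).
Proof.
move=> e0 /ltr_normlP[A1 A2] /ltr_normlP[B1 B2] /ltr_normlP[C1 C2] /ltr_normlP[D1 D2].
have x2 := sqr_ge0 x; have y2 := sqr_ge0 y.
have xyp : 2 * (x * y) <= x ^+ 2 + y ^+ 2
  by have := sqr_ge0 (x - y); rewrite sqrrB mulr_natl; lra.
have xyn : - (x ^+ 2 + y ^+ 2) <= 2 * (x * y)
  by have := sqr_ge0 (x + y); rewrite sqrrD mulr_natl; lra.
have HA : x ^+ 2 * (A' - A) <= x ^+ 2 * (eps / 2) by apply: ler_wpM2l => //; lra.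
have HD : y ^+ 2 * (D' - D) <= y ^+ 2 * (eps / 2) by apply: ler_wpM2l => //; lra.
have HBC : x * y * (B' + C' - B - C) <= (x ^+ 2 + y ^+ 2) / 2 * eps.
  have hBC : `|B' + C' - B - C| <= eps by rewrite ler_norml; apply/andP; split; lra.
  have hxy : `|x * y| <= (x ^+ 2 + y ^+ 2) / 2 by rewrite ler_norml; apply/andP; split; lra.
  by apply: le_trans (ler_norm _) _; rewrite normrM; apply: ler_pM.
nra.
Qed.

(** Tangency removes the linear term of the Taylor formula; [eps] absorbs the variation of the
    Hessian between [p] and the intermediate point. *)
Lemma complex_taylor W g p d (eps : R) : open W -> C2_on id W g -> W p -> 0 < eps ->
  rderive d g p = 0 -> rderive (imC *: d) g p = 0 ->
  exists b1 b2 : R, exists2 r : R, 0 < r & forall z, Normc.normc z <= r ->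
    g (p + z *: d) <= g p + (quadratic 0 b1 b2 z +
      (laplacian g p d / 4 + eps) * Normc.normc z ^+ 2).
Proof.
move=> oW gC2 Wp eps0 g1 g2; have [gC g2C] := gC2.
set e := imC *: d in g2 *.
(* The trace-free part of half the Hessian on the real plane spanned by [d] and [i d]. *)
exists ((hess g p d d - hess g p e e) / 4), ((hess g p d e + hess g p e d) / 2).
have e2 : 0 < eps / 2 by rewrite divr_gt0.
have near v w : nbhs p [set q | `|hess g p v w - hess g q v w| < eps / 2].
  by have /cvgrPdist_lt := @continuous_hess W g v w p oW gC2 Wp; apply.
have nW : nbhs p W by exact: open_nbhs_nbhs.
have [r r0 H] := near_disc d (filterI (filterI nW (near d d))
  (filterI (filterI (near d e) (near e d)) (near e e))).
exists r => // z zr.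
have near_pt (s : R) : `|s| <= 1 -> Normc.normc (s%:C * z) <= r.
  move=> s1; rewrite Normc.normcM /= expr0n addr0 sqrtr_sqr.
  by apply: le_trans zr; rewrite ler_piMl // (le_trans (normr_ge0 _) (Re_le_normc z)).
have [|s s1 ->] := @taylor2 _ _ W g p (z *: d) oW gC2.
  by move=> s s1; rewrite scalerA; have [[]] := H _ (near_pt s s1).
rewrite scalerA; have [[Wq Hdd] [[Hde Hed] Hee]] := H _ (near_pt s s1).
rewrite [z *: d]complex_scaleE -/e.
have -> : rderive ((complex.Re z)%:C *: d + (complex.Im z)%:C *: e) g p = 0.
  by rewrite (C1_rderiveD _ _ oW gC Wp) !(C1_rderiveZ _ _ oW gC Wp) g1 g2 !mulr0 addr0.
rewrite -[rderive _ (rderive _ g) _]/(hess g _ _ _) (hessD _ _ _ _ oW gC2 Wq).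
rewrite addr0 lerD2l normc_sqr /quadratic /laplacian -/e add0r.
exact: quadratic_form_close Hdd Hde Hed Hee.
Qed.

(** * Elementary estimates for the exponential, and exclusion of touching *)

Lemma expR_le_quadratic (y : R) : y <= 2^-1 -> expR y <= 1 + y + 2 * y ^+ 2.
Proof.
move=> y2; have e0 := expR_gt0 y; have e1 := expR_ge1Dx (- y).
have E : expR y * expR (- y) = 1 by rewrite -expRD subrr expR0.
(* From exp (- y) >= 1 - y; and (1 - y) (1 + y + 2 y^2) = 1 + y^2 (1 - 2 y) is at least 1 for y <=
   1/2. *)
have : expR y * (1 - y) <= 1 by rewrite -E; apply: ler_wpM2l; [exact: ltW|lra].
have y1 : 0 < 1 - y by lra.
rewrite -ler_pdivlMr // div1r => /le_trans; apply.
by rewrite -div1r ler_pdivrMr //; have := sqr_ge0 y; nra.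
Qed.

(** Here [rho] stands for |z|^2, and [X], [Y] for the two harmonic quadratics. The bound [T] for [t]
    has size at most [C rho], so the quadratic term of the exponential is of order rho^2; for small
    [rho] it uses up only half of the negative term, leaving [L / 4] of [L / 2]. *)
Lemma exp_increment_le (N L b1 b2 X Y rho t : R) :
  let C := `|b1| + `|b2| - L / 2 in
  0 < N -> L < 0 -> 0 <= rho -> `|X| <= rho -> `|Y| <= rho ->
  N * C * rho <= 2^-1 -> 8 * (N * C ^+ 2) * rho <= - L ->
  t <= b1 * X + b2 * Y + L / 2 * rho ->
  expR (N * t) - 1 <= N * (b1 * X + b2 * Y + L / 4 * rho).
Proof.
move=> C N0 L0 rho0 Xr Yr small1 small2 tT.
set T := b1 * X + b2 * Y + L / 2 * rho in tT.
have TC : `|T| <= C * rho.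
  rewrite /C /T; apply: le_trans (ler_normD _ _) _; rewrite mulrDl.
  apply: lerD; last by rewrite normrM (ger0_norm rho0) ler_wpM2r // ler0_norm; lra.
  apply: le_trans (ler_normD _ _) _; rewrite mulrDl !normrM.
  by apply: lerD; apply: ler_wpM2l.
have T2 : T ^+ 2 <= (C * rho) ^+ 2.
  by rewrite -(real_normK (num_real T)) lerXn2r // nnegrE (le_trans (normr_ge0 T)).
have NT : N * T <= 2^-1.
  apply: le_trans small1; rewrite -mulrA; apply: ler_wpM2l; first exact: ltW.
  exact: le_trans (ler_norm T) TC.
have E1 : expR (N * t) <= 1 + N * T + 2 * (N * T) ^+ 2.
  apply: le_trans (expR_le_quadratic NT); rewrite ler_expR.
  by apply: ler_wpM2l tT; exact: ltW.
have E2 : 2 * (N * T) ^+ 2 <= N * (- L / 4 * rho).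
  have H1 : 2 * (N * T) ^+ 2 <= 2 * (N ^+ 2 * (C * rho) ^+ 2).
    by rewrite exprMn; apply: ler_wpM2l => //; apply: ler_wpM2l => //; exact: sqr_ge0.
  apply: le_trans H1 _.
  have -> : 2 * (N ^+ 2 * (C * rho) ^+ 2) = N * (rho * (8 * (N * C ^+ 2) * rho / 4)) by field.
  apply: ler_wpM2l; first exact: ltW.
  by rewrite [X in X <= _]mulrC; apply: ler_wpM2r => //; lra.
have -> : N * (b1 * X + b2 * Y + L / 4 * rho) = N * T + N * (- L / 4 * rho).
  by rewrite /T; field.
by move: E1 E2; lra.
Qed.

Lemma exists_small_radius (r1 r2 A B L : R) : 0 < r1 -> 0 < r2 -> 0 <= A -> 0 <= B -> L < 0 ->
  exists r, [/\ 0 < r, r <= r1, r <= r2, A * r ^+ 2 <= 2^-1 & B * r ^+ 2 <= - L].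
Proof.
move=> r10 r20 A0 B0 L0.
have A1 : 0 < 2 * (A + 1) by lra.
have B1 : 0 < B + 1 by lra.
(* The entry 1 gives r^2 <= r, so linear bounds on [r] suffice; adding 1 to [A] and [B] avoids
   division by zero. *)
exists (Num.min (Num.min r1 r2) (Num.min 1 (Num.min (2 * (A + 1))^-1 (- L / (B + 1))))).
set r := Num.min _ _.
have r0 : 0 < r.
  by rewrite /r !lt_min r10 r20 ltr01 /= invr_gt0 A1 divr_gt0 // oppr_gt0.
have : r <= r by [].
rewrite {2}/r !le_min => /andP[/andP[rr1 rr2] /andP[r_1 /andP[rA rB]]].
have r2r : r ^+ 2 <= r by rewrite expr2 ler_piMr // ltW.
have sq : 0 <= r ^+ 2 by exact: sqr_ge0.
clearbody r; split => //.
  have := le_trans r2r rA; rewrite -div1r ler_pdivlMr // => H; nra.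
have := le_trans r2r rB; rewrite ler_pdivlMr // => H; nra.
Qed.

Lemma normr_sqrB_le (x y : R) : `|x ^+ 2 - y ^+ 2| <= x ^+ 2 + y ^+ 2.
Proof.
by have := sqr_ge0 x; have := sqr_ge0 y => *; rewrite ler_norml; apply/andP; split; lra.
Qed.

Lemma normr_mul_le (x y : R) : `|x * y| <= x ^+ 2 + y ^+ 2.
Proof.
have := sqr_ge0 (x + y); have := sqr_ge0 (x - y); have := sqr_ge0 x; have := sqr_ge0 y.
by rewrite sqrrB sqrrD => *; rewrite ler_norml; apply/andP; split; lra.
Qed.

(* Since d is complex tangent to the level set of g at p, the right-hand side has
   no first-order term along the line p + C d: it is at most a harmonic quadratic
   minus a multiple of |z|^2, against which subharmonicity on one small disc is
   contradictory.  Tangency removes the need for curved analytic discs. *)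
Lemma no_exponential_touching U W g u p d (H N : R) :
  open W -> C2_on id W g -> W p -> nbhs p U ->
  plurisubharmonic U (fun z => (u z)%:E) ->
  euclidean_norm d = 1 -> rderive d g p = 0 -> rderive (imC *: d) g p = 0 ->
  laplacian g p d < 0 -> 0 < H -> 0 < N ->
  (\forall x \near p, u x <= u p + H * (expR (N * (g x - g p)) - 1)) -> False.
Proof.
move=> oW gC2 Wp pU [_ psh] d1 gd gid lap H0 N0 touch.
set L := laplacian g p d / 4; have L0 : L < 0 by rewrite /L ltr_pdivrMr ?mul0r.
(* With this [eps] the coefficient of |z|^2 is still [L / 2 < 0]. *)
have e0 : 0 < - L / 2 by rewrite divr_gt0 // oppr_gt0.
have [b1 [b2 [r1 r10 taylor]]] := complex_taylor oW gC2 Wp e0 gd gid.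
have [r2 r20 near] := near_disc d (filterI pU touch).
set C := `|b1| + `|b2| - L / 2.
have C0 : 0 <= C by rewrite /C addr_ge0 ?addr_ge0 // -mulNr ltW.
have NC : 0 <= N * C by rewrite mulr_ge0 // ltW.
have NC2 : 0 <= 8 * (N * C ^+ 2) by rewrite !mulr_ge0 ?sqr_ge0 // ltW.
have [r [r0 rr1 rr2 small1 small2]] := exists_small_radius r10 r20 NC NC2 L0.
have Up : U p by exact: nbhs_singleton.
have sub := psh p d Up d1.
(* On the circle |z|^2 is the constant r^2, so the negative term may be moved into the constant of a
   harmonic majorant. At the centre that majorant lies below [u p]. *)
have bound z : circle 0 r z -> u (p + z *: d) <=
    quadratic (u p + H * N * (L / 4) * r ^+ 2) (H * N * b1) (H * N * b2) z.
  rewrite /circle /= subr0 => zr.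
  have zr1 : Normc.normc z <= r1 by rewrite zr.
  have zr2 : Normc.normc z <= r2 by rewrite zr.
  have [_ /= uz] := near z zr2.
  have := taylor z zr1; rewrite /quadratic add0r zr -/L -lerBlDl => gz.
  apply: le_trans uz _.
  have zz : complex.Re z ^+ 2 + complex.Im z ^+ 2 = r ^+ 2 by rewrite -normc_sqr zr.
  have X : `|complex.Re z ^+ 2 - complex.Im z ^+ 2| <= r ^+ 2.
    by rewrite -zz; exact: normr_sqrB_le.
  have Y : `|complex.Re z * complex.Im z| <= r ^+ 2.
    by rewrite -zz; exact: normr_mul_le.
  have Lh : L + - L / 2 = L / 2 by field.
  rewrite Lh in gz.
  have := exp_increment_le N0 L0 (sqr_ge0 r) X Y small1 small2 gz.
  move/(ler_wpM2l (ltW H0)) => Hexp.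
  rewrite -addrA lerD2l; apply: le_trans Hexp _.
  by rewrite le_eqVlt; apply/orP; left; apply/eqP; ring.
have HN : 0 < H * N by rewrite mulr_gt0.
have neg : H * N * (L / 4) * r ^+ 2 < 0.
  by rewrite pmulr_llt0 ?exprn_gt0 // pmulr_rlt0 // ltr_pdivrMr ?mul0r.
have Wr : closed_disc 0 r `<=` [set z | U (p + z *: d)].
  move=> z; rewrite /closed_disc /= subr0 => zr.
  by have [] := near z (le_trans zr rr2).
have := subharmonic_center_le sub r0 Wr bound; rewrite scale0r addr0 => cen.
by move: cen; rewrite lerDl leNgt neg.
Qed.

(** * The squared distance as a C^2 perturbation *)

Lemma coordCnD j v w : coordCn j (v + w) = coordCn j v + coordCn j w.
Proof. by rewrite /coordCn !mxE; case: j.2; rewrite raddfD. Qed.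

Lemma coordCnB j v w : coordCn j (v - w) = coordCn j v - coordCn j w.
Proof. by rewrite /coordCn !mxE; case: j.2; rewrite raddfB. Qed.

Lemma coordCnZ j (t : R) v : coordCn j (t%:C *: v) = t * coordCn j v.
Proof.
by rewrite /coordCn !mxE; case: j.2; case: (v ord0 j.1) => x y /=; rewrite mul0r ?subr0 ?addr0.
Qed.

(** The Euclidean distance is used because the sup norm of the ambient space has no C^2 square in
    general. *)
Definition sqdist a x : R := \sum_j coordCn j (x - a) ^+ 2.

(** Twice the real inner product: the constant Hessian of [sqdist a]. *)
Definition dot v w : R := \sum_j 2 * coordCn j v * coordCn j w.

Lemma sqdist_gt0 a x : x != a -> 0 < sqdist a x.
Proof.
move=> xa; have pos j : 0 <= coordCn j (x - a) ^+ 2 by exact: sqr_ge0.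
rewrite lt_neqAle sumr_ge0 // andbT; apply: contra xa => /eqP/esym/psumr_eq0P H.
rewrite -subr_eq0; apply/eqP; rewrite (frameCn_span (x - a)) big1 // => j _.
have /eqP := H (fun j _ => pos j) j isT; rewrite sqrf_eq0 => /eqP ->.
by rewrite scale0r.
Qed.

Lemma sqdist_center a : sqdist a a = 0.
Proof. by rewrite /sqdist big1 // => j _; rewrite coordCnB subrr expr0n. Qed.

Lemma rderive_sqdist a p v :
  rderivable (sqdist a) p v /\ rderive v (sqdist a) p = dot (p - a) v.
Proof.
apply: (@rderive_quadratic _ _ _ _ _ _ (\sum_j coordCn j v ^+ 2)) => t.
rewrite /sqdist /dot !mulr_sumr -!big_split /=; apply: eq_bigr => j _.
by rewrite !coordCnB coordCnD coordCnZ; ring.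
Qed.

Lemma rderive_dot a p v w :
  rderivable (fun q => dot (q - a) v) p w /\ rderive w (fun q => dot (q - a) v) p = dot w v.
Proof.
apply: (@rderive_quadratic _ _ _ _ _ _ 0) => t.
rewrite mulr0 addr0 /dot !mulr_sumr -!big_split /=; apply: eq_bigr => j _.
by rewrite !coordCnB coordCnD coordCnZ; ring.
Qed.

Lemma rderive_sqdistE a v : rderive v (sqdist a) = fun p => dot (p - a) v.
Proof. by apply/funext => p; rewrite (rderive_sqdist a p v).2. Qed.

Lemma continuous_dot a v : continuous (fun p => dot (p - a) v).
Proof.
move=> p; apply: continuous_at_sum => j.
apply: continuous_at_mul; last exact: continuous_at_cst.
apply: continuous_at_mul; first exact: continuous_at_cst.
rewrite (_ : (fun q => _) = fun q => coordCn j q - coordCn j a); last first.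
  by apply/funext => q; rewrite coordCnB.
by apply: continuous_at_sub; [exact: continuous_coordCn|exact: continuous_at_cst].
Qed.

Lemma C2_sqdist a W : C2_on id W (sqdist a).
Proof.
split=> v.
  split=> [p _|]; first exact: (rderive_sqdist a p v).1.
  by rewrite rderive_sqdistE; apply: continuous_subspaceT; exact: continuous_dot.
rewrite rderive_sqdistE => w; split=> [p _|]; first exact: (rderive_dot a p v w).1.
rewrite (_ : rderive _ _ = fun=> dot w v); last first.
  by apply/funext => p; rewrite (rderive_dot a p v w).2.
by apply: continuous_subspaceT => p; exact: continuous_at_cst.
Qed.

Lemma dot_ge0 v : 0 <= dot v v.
Proof. by apply: sumr_ge0 => j _; rewrite -mulrA -expr2 mulr_ge0 // sqr_ge0. Qed.

Lemma hess_add W f g p v w : open W -> C2_on id W f -> C2_on id W g -> W p ->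
  hess (fun z => f z + g z) p v w = hess f p v w + hess g p v w.
Proof.
move=> oW [fC f2C] [gC g2C] Wp; rewrite /hess.
rewrite (@rderive_congr _ _ W _ (fun z => rderive v f z + rderive v g z)) //.
- exact: rderive_add (f2C v) (g2C v) Wp.
- by move=> q; rewrite inE => Wq; exact: rderive_add Wq.
- exact: C1_add (f2C v) (g2C v).
Qed.

Lemma hess_scale W f (c : R) p v w : open W -> C2_on id W f -> W p ->
  hess (fun z => c * f z) p v w = c * hess f p v w.
Proof.
move=> oW [fC f2C] Wp; rewrite /hess.
rewrite (@rderive_congr _ _ W _ (fun z => c * rderive v f z)) //.
- exact: rderive_scale (f2C v) Wp.
- by move=> q; rewrite inE => Wq; exact: rderive_scale Wq.
- exact: C1_scale (f2C v).
Qed.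

Lemma laplacian_perturb W f (c : R) a p d : open W -> C2_on id W f -> W p ->
  laplacian (fun z => f z + c * sqdist a z) p d =
    laplacian f p d + c * (dot d d + dot (imC *: d) (imC *: d)).
Proof.
move=> oW fC2 Wp; have sC := C2_sqdist a W.
have H v : hess (fun z => f z + c * sqdist a z) p v v = hess f p v v + c * dot v v.
  rewrite (hess_add _ _ oW fC2 (C2_scale c oW sC) Wp) (hess_scale _ _ _ oW sC Wp).
  by congr (_ + _ * _); rewrite /hess rderive_sqdistE (rderive_dot _ _ _ _).2.
apply: etrans (f_equal2 +%R (H d) (H (imC *: d))) _; rewrite /laplacian.
by move: (hess _ _ _ _) (hess _ _ _ _) (dot _ _) (dot _ _) => *; ring.
Qed.

(** * Complex tangent directions at nearby points *)

Lemma hess_comb3 W f p v0 v1 v2 (s t : R) : open W -> C2_on id W f -> W p ->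
  let w := v0 + s%:C *: v1 + t%:C *: v2 in
  hess f p w w = hess f p v0 v0 + s * s * hess f p v1 v1 + t * t * hess f p v2 v2
    + (2 * s) * hess f p v0 v1 + (2 * t) * hess f p v0 v2 + (2 * s * t) * hess f p v1 v2.
Proof.
move=> oW fC2 Wp w; have [fC f2C] := fC2.
have Dr u : hess f p u w = hess f p u v0 + s * hess f p u v1 + t * hess f p u v2.
  by rewrite /hess /w !(C1_rderiveD _ _ oW (f2C u) Wp) !(C1_rderiveZ _ _ oW (f2C u) Wp).
have S v' w' : hess f p v' w' = hess f p w' v' by exact: hess_sym fC2 Wp.
rewrite Dr (S w v0) (S w v1) (S w v2) (Dr v0) (Dr v1) (Dr v2).
rewrite (S v1 v0) (S v2 v0) (S v2 v1).
move: (hess f p v0 v0) (hess f p v1 v1) (hess f p v2 v2).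
by move: (hess f p v0 v1) (hess f p v0 v2) (hess f p v1 v2) => *; ring.
Qed.

(** The direction moves with the base point, while C^2 regularity speaks of fixed directions. The
    expansion into fixed directions is polynomial in [s] and [t], which settles the matter. *)
Lemma continuous_hess_comb3 W f a v0 v1 v2 (s t : Cn -> R) :
  open W -> C2_on id W f -> W a -> continuous_at a s -> continuous_at a t ->
  continuous_at a (fun p => hess f p (v0 + (s p)%:C *: v1 + (t p)%:C *: v2)
                                     (v0 + (s p)%:C *: v1 + (t p)%:C *: v2)).
Proof.
move=> oW fC2 Wa cs ct; apply: (@continuous_at_eq _ _ _ W _ _ _ oW _ Wa).
  by move=> p; rewrite inE => Wp; exact: (hess_comb3 _ _ _ _ _ oW fC2 Wp).
have ch v w := @continuous_hess W f v w a oW fC2 Wa.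
have c2 := @continuous_at_cst R Cn 2 a.
have cm (f1 g1 : Cn -> R) := @continuous_at_mul R Cn f1 g1 a.
have ca (f1 g1 : Cn -> R) := @continuous_at_add R Cn f1 g1 a.
exact: (ca _ _ (ca _ _ (ca _ _ (ca _ _ (ca _ _ (ch v0 v0)
  (cm _ _ (cm _ _ cs cs) (ch v1 v1))) (cm _ _ (cm _ _ ct ct) (ch v2 v2)))
  (cm _ _ (cm _ _ c2 cs) (ch v0 v1))) (cm _ _ (cm _ _ c2 ct) (ch v0 v2)))
  (cm _ _ (cm _ _ (cm _ _ c2 cs) ct) (ch v1 v2))).
Qed.

Lemma continuous_at_div (f g : Cn -> R) p : continuous_at p f -> continuous_at p g -> g p != 0 ->
  continuous_at p (fun q => f q / g q).
Proof. by move=> cf cg g0; apply: continuous_at_mul => //; exact: (cvgV g0 cg). Qed.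

Lemma euclidean_normZ (c : R) d : 0 <= c -> euclidean_norm (c%:C *: d) = c * euclidean_norm d.
Proof.
move=> c0; rewrite /euclidean_norm -{2}(ger0_norm c0) -sqrtr_sqr -sqrtrM ?sqr_ge0 // mulr_sumr.
congr Num.sqrt; apply: eq_bigr => j _; rewrite mxE Normc.normcM exprMn /=.
by rewrite expr0n addr0 sqrtr_sqr real_normK ?num_real.
Qed.

Lemma euclidean_norm_gt0 d : d != 0 -> 0 < euclidean_norm d.
Proof.
move=> d0; rewrite sqrtr_gt0 lt_neqAle sumr_ge0 ?andbT; last by move=> j _; exact: sqr_ge0.
apply: contra d0 => /eqP/esym/psumr_eq0P H; apply/eqP/rowP => j; rewrite mxE.
apply: Normc.eq0_normc; apply/eqP; rewrite -sqrf_eq0; apply/eqP.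
by apply: H => // k _; exact: sqr_ge0.
Qed.

(** Plurisubharmonicity is stated for unit directions. Negativity forces [d] to be non-zero, and
    rescaling multiplies the Laplacian by a positive square. *)
Lemma unit_tangent W g p d : open W -> C2_on id W g -> W p ->
  rderive d g p = 0 -> rderive (imC *: d) g p = 0 -> laplacian g p d < 0 ->
  exists e, [/\ euclidean_norm e = 1, rderive e g p = 0, rderive (imC *: e) g p = 0 &
    laplacian g p e < 0].
Proof.
move=> oW gC2 Wp g1 g2 lap; have [gC g2C] := gC2.
have d0 : d != 0.
  apply: contraTneq lap => ->; rewrite /laplacian scaler0 -leNgt.
  have := C1_rderiveZ 0 0 oW (g2C 0) Wp; rewrite scale0r mul0r /hess => ->.
  by rewrite addr0.
have n0 := euclidean_norm_gt0 d0; set c := (euclidean_norm d)^-1.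
have c0 : 0 < c by rewrite invr_gt0.
have Hc v : hess g p (c%:C *: v) (c%:C *: v) = c ^+ 2 * hess g p v v.
  have := hessD c 0 v 0 oW gC2 Wp.
  by rewrite scaler0 addr0 mulr0 expr0n !mul0r !addr0.
have cc : imC *: (c%:C *: d) = c%:C *: (imC *: d) by rewrite !scalerA mulrC.
exists (c%:C *: d); split.
- by rewrite euclidean_normZ ?(ltW c0) // mulVf // gt_eqF.
- by rewrite (C1_rderiveZ _ _ oW gC Wp) g1 mulr0.
- by rewrite cc (C1_rderiveZ _ _ oW gC Wp) g2 mulr0.
- rewrite /laplacian cc Hc Hc -mulrDr pmulr_rlt0 //; exact: exprn_gt0.
Qed.

Lemma continuous_at_opp (f : Cn -> R) p : continuous_at p f -> continuous_at p (fun q => - f q).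
Proof. by move=> cf; exact: (cvgN cf). Qed.

(* The two equations are the real and imaginary parts of
   (D - i D') + (s + i t) (E - i E') = 0. *)
Lemma solve_tangent (D D' E E' : Cn -> R) a :
  continuous_at a D -> continuous_at a D' -> continuous_at a E -> continuous_at a E' ->
  D a = 0 -> D' a = 0 -> E a != 0 ->
  exists s t : Cn -> R, [/\ continuous_at a s, continuous_at a t, s a = 0, t a = 0 &
    \forall p \near a, D p + s p * E p + t p * E' p = 0 /\
                        D' p + s p * E' p + - t p * E p = 0].
Proof.
move=> cD cD' cE cE' Da D'a Ea.
pose q p := E p * E p + E' p * E' p.
have cm (f1 g1 : Cn -> R) := @continuous_at_mul R Cn f1 g1 a.
have cq : continuous_at a q := continuous_at_add (cm _ _ cE cE) (cm _ _ cE' cE').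
have q0 : 0 < q a.
  by rewrite /q ltr_pwDl // -expr2 ?sqr_ge0 // exprn_even_gt0.
have qa : q a != 0 by rewrite gt_eqF.
(* [s + i t] is the quotient - (D - i D') / (E - i E'), written over the denominator q = |E - i
   E'|^2. *)
exists (fun p => - ((D p * E p + D' p * E' p) / q p)).
exists (fun p => - ((D p * E' p - D' p * E p) / q p)).
split.
- apply: continuous_at_opp; apply: continuous_at_div => //.
  exact: continuous_at_add (cm _ _ cD cE) (cm _ _ cD' cE').
- apply: continuous_at_opp; apply: continuous_at_div => //.
  exact: continuous_at_sub (cm _ _ cD cE') (cm _ _ cD' cE).
- by rewrite Da D'a !mul0r addr0 mul0r oppr0.
- by rewrite Da D'a !mul0r subr0 mul0r oppr0.
have nq : \forall p \near a, 0 < q p by have /cvgr_gt/(_ _ q0) := cq.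
apply: filterS nq => p qp; have := lt0r_neq0 qp; rewrite /q.
move: (D p) (D' p) (E p) (E' p) => x y z w ne; split; field; exact: ne.
Qed.

Lemma imC_comb d v (s t : R) :
  imC *: (d + s%:C *: v + t%:C *: (imC *: v)) =
    imC *: d + s%:C *: (imC *: v) + (- t)%:C *: v.
Proof.
have E : imC * t%:C * imC = (- t)%:C :> R[i].
  by apply/eqP; rewrite eq_complex /imC /=; apply/andP; split; apply/eqP; ring.
by rewrite scalerDr scalerDr !scalerA E (mulrC imC).
Qed.

Lemma C1_rderive_comb3 W f p v0 v1 v2 (s t : R) : open W -> C1_on id W f -> W p ->
  rderive (v0 + s%:C *: v1 + t%:C *: v2) f p =
    rderive v0 f p + s * rderive v1 f p + t * rderive v2 f p.
Proof.
by move=> oW fC Wp; rewrite !(C1_rderiveD _ _ oW fC Wp) !(C1_rderiveZ _ _ oW fC Wp).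
Qed.

(** At [p] the direction [d] is corrected by the complex multiple [(s + i t) v] that restores
    tangency. The correction is continuous and vanishes at [a], so the Laplacian stays negative
    nearby. *)
Lemma near_tangent W g a d v : open W -> C2_on id W g -> W a ->
  rderive d g a = 0 -> rderive (imC *: d) g a = 0 -> laplacian g a d < 0 ->
  rderive v g a != 0 ->
  \forall p \near a, exists e, [/\ euclidean_norm e = 1, rderive e g p = 0,
    rderive (imC *: e) g p = 0 & laplacian g p e < 0].
Proof.
move=> oW gC2 Wa g1 g2 lap gv; have [gC g2C] := gC2.
have cr w : continuous_at a (rderive w g).
  by have [_ /(within_openP _ oW)] := gC w; apply.
have [s [t [cs ct sa ta st]]] :=
  solve_tangent (cr d) (cr (imC *: d)) (cr v) (cr (imC *: v)) g1 g2 gv.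
pose e p := d + (s p)%:C *: v + (t p)%:C *: (imC *: v).
have cK : continuous_at a (fun p => laplacian g p (e p)).
  apply: continuous_at_add; first exact: continuous_hess_comb3 gC2 Wa cs ct.
  rewrite (_ : (fun p => _) = fun p =>
      hess g p (imC *: d + (s p)%:C *: (imC *: v) + (- t p)%:C *: v)
               (imC *: d + (s p)%:C *: (imC *: v) + (- t p)%:C *: v)).
    exact: continuous_hess_comb3 gC2 Wa cs (continuous_at_opp ct).
  by apply/funext => p; apply: f_equal2; exact: imC_comb.
have Ka : laplacian g a (e a) < 0.
  by rewrite /e sa ta !scale0r !addr0.
have nK : \forall p \near a, laplacian g p (e p) < 0.
  by have /cvgr_lt/(_ _ Ka) := cK.
have nW : nbhs a W by exact: open_nbhs_nbhs.
apply: filterS (filterI nW (filterI nK st)) => p [Wp [Kp [e1 e2]]].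
apply: (unit_tangent oW gC2 Wp (etrans (C1_rderive_comb3 _ _ _ _ _ oW gC Wp) e1) _ Kp).
apply: etrans (f_equal (fun w => rderive w g p) (imC_comb _ _ _ _)) _.
exact: etrans (C1_rderive_comb3 _ _ _ _ _ oW gC Wp) e2.
Qed.

End ComplexLines.

(** * Compact neighbourhoods and compact sublevel sets *)

Section Compactness.
Context {R : realType}.

(** A closed square is the continuous image of a product of two segments. With half-side [r / 4] its
    points have squared distance at most r^2 / 8 from [z]. *)
Lemma compact_nbhs_complex (z : R[i]) (A : set R[i]) : nbhs z A ->
  exists Q : set R[i], [/\ compact Q, nbhs z Q & Q `<=` A].
Proof.
move=> /nbhs_realP[r r0 rA].
pose I (x : R) := `[x - r / 4, x + r / 4]%classic.
pose h (p : R * R) : R[i] := p.1%:C + p.2%:C *: (imC : R[i]).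
have hE x y : h (x, y) = x +i* y.
  by apply/eqP; rewrite eq_complex /= /imC /GRing.scale /=; apply/andP; split; apply/eqP; ring.
have r4 : 0 <= r / 4 by rewrite divr_ge0 // ltW.
have IE (x y : R) : I x y <-> `|y - x| <= r / 4.
  rewrite /I /= in_itv /= ler_norml; split=> /andP[H1 H2]; apply/andP; split; lra.
exists (h @` (I (complex.Re z) `*` I (complex.Im z))); split.
- apply: continuous_compact; last by apply: compact_setX; exact: segment_compact.
  apply: continuous_subspaceT => p; apply: cvgD.
    by apply: cvg_comp; [exact: cvg_fst|exact: continuous_realC].
  by apply: cvgZr_tmp; apply: cvg_comp; [exact: cvg_snd|exact: continuous_realC].
- apply/nbhs_realP; exists (r / 4); first by rewrite divr_gt0.
  move=> w; rewrite normr_normc ltcR => wr.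
  exists (complex.Re w, complex.Im w); last by rewrite hE; case: w {wr}.
  split; apply/IE => /=; rewrite -raddfB ltW //; apply: le_lt_trans wr.
    exact: Re_le_normc.
  exact: Im_le_normc.
- move=> _ [[x y] [/IE /= xr /IE /= yr] <-]; apply: rA.
  rewrite hE; case: z xr yr => z1 z2 /= xr yr; rewrite ltcR.
  have -> : r = Num.sqrt (r ^+ 2) by rewrite sqrtr_sqr gtr0_norm.
  rewrite ltr_sqrt ?exprn_gt0 //.
  have X : `|x - z1| ^+ 2 <= (r / 4) ^+ 2 by rewrite lerXn2r // nnegrE.
  have Y : `|y - z2| ^+ 2 <= (r / 4) ^+ 2 by rewrite lerXn2r // nnegrE.
  rewrite !real_normK ?num_real // in X Y.
  have R2 : 0 < r ^+ 2 by rewrite exprn_gt0.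
  by rewrite exprMn in X Y; move: X Y R2; rewrite (_ : 4^-1 ^+ 2 = 16^-1); [lra|field].
Qed.

Lemma compact_nbhs_Cn n (a : 'rV[R[i]]_n) (A : set 'rV[R[i]]_n) : nbhs a A ->
  exists K : set 'rV[R[i]]_n, [/\ compact K, nbhs a K & K `<=` A].
Proof.
move=> [P /= aP PA].
have /choice[Q QP] : forall j : 'I_n, exists Q : set R[i],
    [/\ compact Q, nbhs (a ord0 j) Q & Q `<=` P ord0 j].
  by move=> j; exact: compact_nbhs_complex (aP ord0 j).
exists [set v | forall j, Q j (v ord0 j)]; split.
- by apply: rV_compact => j; have [] := QP j.
- exists (fun _ j => Q j) => [i j|v /= vQ j]; last exact: vQ.
  by rewrite (ord1 i); have [] := QP j.
- by move=> v vQ; apply: PA => i j; rewrite (ord1 i); have [_ _] := QP j; apply.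
Qed.

Lemma compact_bounded_above (T : topologicalType) (A : set T) (F : T -> R) :
  compact A -> (forall x, A x -> continuous_at x F) -> exists M, forall x, A x -> F x <= M.
Proof.
move=> cA cF; have [A0|/nonemptyPn A0] := pselect (A !=set0); last first.
  by exists 0 => x; rewrite A0.
have [|c _ cM] := compact_EVT_max A0 cA (f := F).
  by apply: continuous_in_subspaceT => x; rewrite inE; exact: cF.
by exists (F c) => x Ax; apply: cM; rewrite inE.
Qed.

Lemma compact_sublevel (T : topologicalType) (K : set T) (g : T -> R) (c : R) :
  hausdorff_space T -> compact K -> (forall x, K x -> continuous_at x g) ->
  compact (K `&` [set x | g x <= c]).
Proof.
move=> hT cK cg; apply: (subclosed_compact _ cK); last by move=> x [].
move=> x clx; have Kx : K x.
  by apply: (compact_closed hT cK); apply: closure_subset clx => y [].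
split => //=; rewrite leNgt; apply/negP => gx.
have /cvgr_gt/(_ _ gx) near := cg x Kx.
by have [y [[_ /= yc] /=]] := clx _ near; rewrite ltNge yc.
Qed.

End Compactness.

(** * The maximum principle and the sign of the Levi form *)

Section LeviPseudoconvexity.
Context {R : realType} {n : nat}.
Local Notation Cn := 'rV[R[i]]_n.
Implicit Types (a p d v w : Cn) (f g u : Cn -> R) (U W K : set Cn).

(** A small step against the sign of the derivative [D], with first-order error at most half of
    [|D|] times the step, decreases [g]. *)
Lemma C1_descent W g a v (A : set Cn) : open W -> C1_on id W g -> W a ->
  rderive v g a != 0 -> nbhs a A -> exists2 x, A x & g x < g a.
Proof.
move=> oW gC Wa Dv aA; set D := rderive v g a in Dv.
have D0 : 0 < `|D| / 2 by rewrite divr_gt0 // normr_gt0.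
have /near2_refl n1 := C1_strict v oW gC Wa D0.
have /near2_refl n2 := near_line v aA.
have [r /= r0 rP] := (@nbhs_normP R R 0 _).1 (filterI n1 n2).
pose t := - Num.sg D * (r / 2).
have tE : `|t| = r / 2.
  by rewrite normrM normrN normr_sg Dv mul1r gtr0_norm // divr_gt0.
have tr : ball_ Num.Def.normr 0 r t.
  by rewrite /= sub0r normrN tE ltr_pdivrMr // ltr_pMr // ltr1n.
have [] := rP t tr; rewrite tE -/D => H At; exists (a + t%:C *: v) => //.
have tD : t * D = - (r / 2 * `|D|).
  by rewrite /t mulNr mulNr mulrAC -normrEsg mulrC.
move: H; rewrite tD => /ler_normlP[_].
have : 0 < r * `|D| by rewrite mulr_gt0 // normr_gt0.
by move: (`|D|) => m; move: (g _) (g _) => x y; lra.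
Qed.

(* With g x0 = - 2 s, maximise u - A exp (N (g + s)) over K cut by g <= - s.  The
   penalty is A, hence prohibitive, where g = - s, and at most 1 at x0; so the
   maximum is attained on the rest of the boundary or in the interior. *)
Lemma psh_sublevel_bound U W K g u (M : R) : open U ->
  (forall x, U x -> continuous_at x u) -> plurisubharmonic U (fun z => (u z)%:E) ->
  open W -> C2_on id W g -> compact K -> K `<=` W ->
  (forall p, K p -> exists e, [/\ euclidean_norm e = 1, rderive e g p = 0,
    rderive (imC *: e) g p = 0 & laplacian g p e < 0]) ->
  (forall x, K x -> g x < 0 -> U x) ->
  (forall x, K x -> ~ nbhs x K -> g x < 0 -> u x <= M) ->
  forall x, K x -> g x < 0 -> u x <= M + 1.
Proof.
have arith (b c d e h : R) : b - c * (d * e) <= h - c * d -> b <= h + c * d * (e - 1).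
  have -> : h + c * d * (e - 1) = h - c * d + c * (d * e) by ring.
  by rewrite lerBlDr.
move=> oU cu psh oW gC2 cK KW tangent KU Mbd x0 Kx0 gx0.
have cg x : K x -> continuous_at x g.
  by move=> /KW Wx; exact: C1_continuousCn oW gC2.1 Wx.
set s := - g x0 / 2; have s0 : 0 < s by rewrite /s divr_gt0 // oppr_gt0.
have gs : g x0 + s = - s by rewrite /s; field.
pose Ks := K `&` [set x | g x <= - s].
have hT : hausdorff_space Cn by exact: norm_hausdorff.
have cKs : compact Ks by exact: compact_sublevel.
have Kslt x : Ks x -> g x < 0 by move=> [_ /= /le_lt_trans]; apply; rewrite oppr_lt0.
have KsU x : Ks x -> U x by move=> Kx; apply: KU; [case: Kx|exact: Kslt].
have [B BP] := compact_bounded_above cKs (fun x Kx => cu x (KsU x Kx)).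
(* Where [g = - s] the penalty is [A], so [A >= B - M] makes [F <= M] there. *)
pose A := Num.max (B - M) 1.
have A1 : 1 <= A by rewrite /A le_max lexx orbT.
have A0 : 0 < A by exact: lt_le_trans A1.
have AB : B - M <= A by rewrite /A le_max lexx.
(* At [x0] the exponent is then [- A], and [A exp (- A) <= 1]; hence [u x0 > M + 1] would give
   [F x0 > M]. *)
pose N := A / s; have N0 : 0 < N by rewrite divr_gt0.
pose F x := u x - A * expR (N * (g x + s)).
have Ks0 : Ks x0 by split => //=; lra.
have cF x : Ks x -> continuous_at x F.
  move=> Kx; apply: continuous_at_sub; first exact: cu (KsU x Kx).
  apply: continuous_at_mul; first exact: continuous_at_cst.
  have cin : continuous_at x (fun x => N * (g x + s)).
    apply: continuous_at_mul; first exact: continuous_at_cst.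
    by apply: continuous_at_add; [exact: cg Kx.1|exact: continuous_at_cst].
  exact: (continuous_comp cin (@continuous_expR R _)).
have [|p] := @compact_EVT_max Cn R F Ks (ex_intro _ x0 Ks0) cKs.
  by apply: continuous_in_subspaceT => x; rewrite inE; exact: cF.
rewrite inE => Ksp Fmax; rewrite leNgt; apply/negP => big.
have Nss : N * - s = - A by rewrite /N mulrN divfK // gt_eqF.
have Aexp : A * expR (- A) <= 1.
  by rewrite expRN ler_pdivrMr ?expR_gt0 // mul1r; apply: le_trans (expR_ge1Dx A); rewrite lerDr.
have Fp : M < F p.
  apply: lt_le_trans (Fmax x0 _); last by rewrite inE.
  by rewrite /F gs Nss; move: Aexp big; move: (A * _) (u x0) => b c; lra.
have gp : g p <= - s := Ksp.2.
have expgt0 := expR_gt0 (N * (g p + s)).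
have Fu : F p < u p by rewrite /F gtrBl mulr_gt0.
have nK : nbhs p K.
  apply: contrapT => /(Mbd p Ksp.1)/(_ (Kslt p Ksp)) uM.
  by have := lt_le_trans (lt_trans Fp Fu) uM; rewrite ltxx.
have gps : g p < - s.
  rewrite lt_neqAle gp andbT; apply/eqP => E.
  move: Fp; rewrite /F E addNr mulr0 expR0 mulr1 => Fp.
  by move: (BP p Ksp) AB Fp; lra.
have [e [e1 eg ieg lap]] := tangent p Ksp.1.
have Up : nbhs p U by apply: open_nbhs_nbhs; split => //; exact: KsU.
have H0 : 0 < A * expR (N * (g p + s)) by rewrite mulr_gt0.
(* Now [p] is interior to [K] with [g p < - s], so maximality of [F] holds on a full neighbourhood;
   factoring out exp (N (g p + s)) turns it into touching. *)
apply: (no_exponential_touching oW gC2 (KW p Ksp.1) Up psh e1 eg ieg lap H0 N0).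
have ng : \forall x \near p, g x < - s by have /cvgr_lt/(_ _ gps) := cg p Ksp.1.
apply: filterS2 nK ng => x Kx gx.
have /Fmax : x \in Ks by rewrite inE; split => //=; exact: ltW.
rewrite /F; have -> : N * (g x + s) = N * (g p + s) + N * (g x - g p) by ring.
by rewrite expRD; exact: arith.
Qed.

Lemma neg_perturb (l m : R) : l < 0 -> 0 <= m -> l + - l / (2 * (m + 1)) * m < 0.
Proof.
move=> l0 m0; have -> : l + - l / (2 * (m + 1)) * m = l * ((m + 2) / (2 * (m + 1))).
  by field; lra.
by rewrite nmulr_rlt0 // divr_gt0 //; lra.
Qed.

Lemma levi_nonneg U W f u a d : open U ->
  (forall x, U x -> continuous_at x u) -> plurisubharmonic U (fun z => (u z)%:E) ->
  exhaustion U u -> open W -> C2_on id W f -> W a -> f a = 0 ->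
  U `&` W = W `&` [set z | f z < 0] ->
  (exists v, rderive v f a != 0) ->
  rderive d f a = 0 -> rderive (imC *: d) f a = 0 -> 0 <= laplacian f a d.
Proof.
move=> oU cu psh exh oW fC2 Wa fa UW [v Dv] fd fid; rewrite leNgt; apply/negP => lap.
set m := dot d d + dot (imC *: d) (imC *: d).
have m0 : 0 <= m by rewrite addr_ge0 // dot_ge0.
have m1 : 0 < 2 * (m + 1) by rewrite mulr_gt0 // ltr_wpDl.
(* The perturbation adds [c m] to the Laplacian, less than half of its absolute value. *)
set c := - laplacian f a d / (2 * (m + 1)).
have c0 : 0 < c by rewrite divr_gt0 // oppr_gt0.
pose g z := f z + c * sqdist a z.
have sC2 := C2_scale c oW (C2_sqdist a W).
have gC2 : C2_on id W g by exact: C2_add fC2 sC2.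
(* [sqdist a] is critical at [a], so tangency of [d] carries over to [g]. *)
have Dg w : rderive w g a = rderive w f a.
  rewrite (rderive_add _ oW fC2.1 sC2.1 Wa) (rderive_scale _ _ oW (C2_sqdist a W).1 Wa).
  rewrite rderive_sqdistE subrr /dot big1 ?mulr0 ?addr0 // => j _.
  by rewrite -(subrr a) coordCnB subrr mulr0 mul0r.
have lapg : laplacian g a d < 0.
  rewrite (laplacian_perturb _ _ _ oW fC2 Wa) -/m /c.
  exact: neg_perturb.
have ga : g a = 0 by rewrite /g fa sqdist_center mulr0 addr0.
have tan := near_tangent oW gC2 Wa (etrans (Dg d) fd) (etrans (Dg _) fid) lapg
  (eq_ind_r (fun t => t != 0) Dv (Dg v)).
have nW : nbhs a W by exact: open_nbhs_nbhs.
have [K [cK aK KP]] := compact_nbhs_Cn (filterI nW tan).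
have gU x : W x -> g x <= 0 -> x != a -> U x.
  move=> Wx gx xa; suff : (U `&` W) x by case.
  rewrite UW; split => //=; apply: lt_le_trans gx.
  by rewrite ltrDl mulr_gt0 // sqdist_gt0.
have gxa x : g x < 0 -> x != a by apply: contraTneq => ->; rewrite ga ltxx.
have hT : hausdorff_space Cn by exact: norm_hausdorff.
have cg x : K x -> continuous_at x g.
  by move=> /KP[Wx _]; exact: C1_continuousCn oW gC2.1 Wx.
(* [S] misses [a], which is interior to [K], and so is a compact subset of [U]. Its bound [M] serves
   every sublevel set of [g] at once. *)
pose S := (K `&` [set x | g x <= 0]) `&` ~` interior K.
have cS : compact S.
  have cKg : compact (K `&` [set x | g x <= 0]) by exact: compact_sublevel.
  apply: (subclosed_compact _ cKg); last by move=> x [].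
  apply: closedI; first exact: compact_closed hT cKg.
  exact: open_closedC (@open_interior _ K).
have [M MP] : exists M, forall x, S x -> u x <= M.
  apply: compact_bounded_above => // x [[Kx gx] nKx]; apply: cu.
  have xa : x != a by apply/eqP => xa; apply: nKx; rewrite xa.
  exact: (gU x (KP x Kx).1 gx xa).
have bound : forall x, K x -> g x < 0 -> u x <= M + 1.
  apply: (psh_sublevel_bound oU cu psh oW gC2 cK).
  - by move=> x /KP[].
  - by move=> p /KP[].
  - by move=> x Kx gx; exact: (gU x (KP x Kx).1 (ltW gx) (gxa x gx)).
  - by move=> x Kx nKx gx; exact: (MP x (conj (conj Kx (ltW gx)) nKx)).
(* Points with [g < 0] exist arbitrarily near [a] and satisfy [u <= M + 1]. The sublevel set of [u]
   is compact, hence closed, so [a] would lie in [U], against [f a = 0]. *)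
have : closure (U `&` [set z | u z <= M + 1]) a.
  move=> B aB.
  have gv : rderive v g a != 0 by rewrite Dg.
  have [x [Bx Kx] gx] := C1_descent oW gC2.1 Wa gv (filterI aB aK).
  rewrite ga in gx; exists x; split => //; split; last exact: bound.
  exact: (gU x (KP x Kx).1 (ltW gx) (gxa x gx)).
move/(compact_closed hT (exh (M + 1))) => [Ua _].
have : (U `&` W) a by [].
by rewrite UW => -[_ /=]; rewrite fa ltxx.
Qed.

End LeviPseudoconvexity.

(** * Boundary points as zeros of a defining function *)

Section Boundary.
Context {R : realType} {n : nat}.
Local Notation Cn := 'rV[R[i]]_n.
Implicit Types (a p d v w : Cn) (f g u : Cn -> R) (U V W : set Cn).

Lemma C2_on_subset I (e : I -> Cn) V W f : W `<=` V -> C2_on e V f -> C2_on e W f.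
Proof.
have C1 g : W `<=` V -> C1_on e V g -> C1_on e W g.
  move=> WV gC i; have [dg cg] := gC i; split=> [p /WV|]; first exact: dg.
  exact: continuous_subspaceW cg.
by move=> WV [fC f2C]; split=> [|i]; exact: C1.
Qed.

Lemma gradient_neq0 f a : gradient f a != 0 -> exists v, rderive v f a != 0.
Proof.
apply: contraNP => H.
have H0 v : rderive v f a = 0.
  by apply/eqP/negPn/negP => Hv; apply: H; exists v.
apply/eqP; apply: etrans (row_mx0 _ _ _ _).
by apply: (f_equal2 (@row_mx R 1 n n)); apply/rowP => j; rewrite !mxE; exact: H0.
Qed.

(** Continuity makes points with [f > 0] exterior, and openness of [U] makes those with [f < 0]
    interior. At a zero, the non-vanishing derivative yields nearby points with [f < 0]. *)
Lemma bdry_zero_set U V f v : open U -> open V -> C1_on id V f ->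
  U `&` V = V `&` [set z | f z < 0] -> (forall x, V x -> rderive v f x != 0) ->
  bdry U `&` V = V `&` [set z | f z = 0].
Proof.
move=> oU oV fC UV Dv.
have inU x : V x -> U x <-> f x < 0.
  move=> Vx; split=> [Ux|fx]; last first.
    by have [] : (U `&` V) x by rewrite UV.
  by have [] : (V `&` [set z | f z < 0]) x by rewrite -UV.
have nV x : V x -> nbhs x V by move=> Vx; exact: open_nbhs_nbhs.
apply/seteqP; split=> x [].
  move=> [clx nUx] Vx; split => //=; apply/eqP; rewrite eq_le; apply/andP; split.
    rewrite leNgt; apply/negP => fx.
    have /cvgr_gt/(_ _ fx) near := C1_continuousCn oV fC Vx.
    have [y [Uy [Vy /=]]] := clx _ (filterI (nV x Vx) near).
    by move/(inU y Vy) : Uy; case: ltgtP.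
  rewrite leNgt; apply/negP => fx; apply: nUx.
  by apply: open_nbhs_nbhs; split => //; apply/(inU x Vx).
move=> Vx /= fx; split => //; split.
  move=> B xB; have [y [By Vy] fy] := C1_descent oV fC Vx (Dv x Vx) (filterI xB (nV x Vx)).
  by exists y; split => //; apply/(inU y Vy); rewrite -fx.
by move=> /interior_subset /(inU x Vx); rewrite fx ltxx.
Qed.

End Boundary.

Theorem theorem4p29 (R : realType) (n : nat) (U : set 'rV[R[i]]_n)
  (hU : pseudoconvex U) (hbd : C2_boundary U) :
  levi_pseudoconvex U.
Proof.
have [[oU cU] [u [cu psh exh]]] := hU.
split => // a aU; have [V [f [[[oV Va] UV] fC2 grad]]] := hbd a aU.
have [v Dv] := gradient_neq0 grad.
have fC2V := C2_frameCn oV fC2.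
(* Non-degeneracy is given at [a] only; shrinking to [W] keeps one fixed direction [v] non-critical
   throughout, so that the zero set of [f] in [W] is the boundary. *)
pose W := interior (V `&` [set x | rderive v f x != 0]).
have WV : W `<=` V by move=> x /interior_subset[].
have oW : open W by exact: open_interior.
have Wa : W a.
  have nV : nbhs a V by exact: open_nbhs_nbhs.
  apply: filterI nV _.
  have cv : {for a, continuous (rderive v f)}.
    by have [_ /(within_openP _ oV)] := fC2V.1 v; apply.
  have D0 : 0 < `|rderive v f a| by rewrite normr_gt0.
  have /cvgrPdist_lt/(_ _ D0) := cv; apply: filterS => x /=.
  by apply: contraTneq => ->; rewrite subr0 ltxx.
have fC2W := C2_on_subset WV fC2; have fC2id := C2_frameCn oW fC2W.
have UW : U `&` W = W `&` [set z | f z < 0].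
  apply/seteqP; split=> x [].
    by move=> Ux Wx; have [] : (V `&` [set z | f z < 0]) x by rewrite -UV; split => //; exact: WV.
  by move=> Wx fx; have [] : (U `&` V) x by rewrite UV; split => //; exact: WV.
have zero : bdry U `&` W = W `&` [set z | f z = 0].
  by apply: (@bdry_zero_set _ _ U W f v) => // [|x /interior_subset[]//]; exact: fC2id.1.
have fa : f a = 0 by have : (bdry U `&` W) a by []; rewrite zero => -[].
exists W, f; split => //.
move=> d /(complex_tangentP _ oW fC2id.1 Wa)[d1 d2].
rewrite (levi_formE _ oW fC2id Wa) -[0]/(0%:C) lecR divr_ge0 //.
have cuU x : U x -> continuous_at x u by move=> Ux; move/(within_openP _ oU) : cu; apply.
apply: levi_nonneg oU cuU psh exh oW fC2id Wa fa UW _ d1 d2; by exists v.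
Qed.
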